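(* For each $n$ let $\Sigma\in\mathbb R^{n\times n}$ be symmetric positive definite and $\Gamma\in\mathbb R^{n\times n}$ be diagonal with entries $\gamma_i>0$, and suppose that $\|\Sigma\|,\|\Sigma^{-1}\|,\|\Gamma\|,\|\Gamma^{-1}\|$ are $O(1)$ with respect to $n$, and that all edges are allowed. For each $i\in[n]$ let $X_i\in\mathbb R^{n\times m}$ have columns $X_i^{(1)},\dots,X_i^{(m)}$ drawn independently from $\mathcal N(\mathbf 0,\Sigma)$, and let $\hat{\boldsymbol\mu}_i=\frac1m\sum_{s=1}^mX_i^{(s)}$ and $\hat\Sigma_i=\frac1{m-1}\sum_{s=1}^m(X_i^{(s)}-\hat{\boldsymbol\mu}_i)(X_i^{(s)}-\hat{\boldsymbol\mu}_i)^T$. Let $\hat\eta^\star$ be the maximum dampening factor for the covariances $(\hat\Sigma_i)_{i\in[n]}$, and let $\eta^\star$ be the maximum dampening factor when $\hat\Sigma_i$ is replaced by $\Sigma$ for all $i$. If $m=\lceil n\log n\rceil$, then for large enough $n$, $\hat\eta^\star\ge(1-o(1))\,\eta^\star$ with probability at least $1-\exp(-\Omega(n))$.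
   Context: $[n]=\{1,\dots,n\}$; $\mathbf e_1,\dots,\mathbf e_n$ is the standard basis of $\mathbb R^n$; $\otimes$ is the Kronecker product; $\|\cdot\|$ is the operator norm; asymptotic notation is as $n\to\infty$. Maximum dampening factor (all edges allowed): given symmetric positive definite matrices $S_1,\dots,S_n\in\mathbb R^{n\times n}$ and $\gamma_1,\dots,\gamma_n>0$, let $Q_i=(2\gamma_iS_i)^{-1}$, let $$K=\sum_{r=1}^n\big(\mathbf e_r\mathbf e_r^T\otimes Q_r+Q_r\otimes\mathbf e_r\mathbf e_r^T\big)\in\mathbb R^{n^2\times n^2},$$ and let $L\in\mathbb R^{n^2\times n^2}$ be diagonal with $L_{(i-1)n+j,(i-1)n+j}=(Q_i)_{jj}+(Q_j)_{ii}$ for $i,j\in[n]$. The maximum dampening factor is $2/\lambda_{\max}$, where $\lambda_{\max}$ is the largest eigenvalue of $L^{-1}K$. Thus $\hat\eta^\star$ uses $S_i=\hat\Sigma_i$ and $\eta^\star$ uses $S_i=\Sigma$, with the same $\gamma_i=\Gamma_{ii}$. *)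

(* Defs.v *)
From HB Require Import structures.
From mathcomp Require Export all_boot all_order all_algebra.
From mathcomp Require Export mxtens.
From mathcomp Require Export all_classical all_reals all_analysis.
Export Order.TTheory GRing.Theory Num.Theory.
Export numFieldNormedType.Exports.

Set Implicit Arguments.
Unset Strict Implicit.
Unset Printing Implicit Defensive.

Local Open Scope classical_set_scope.
Local Open Scope ring_scope.

Definition posdefmx (R : realType) (n : nat) (A : 'M[R]_n) : Prop :=
  A^T = A /\ forall v : 'cV[R]_n, v != 0 -> 0 < (v^T *m A *m v) 0 0.

(* The norm that MathComp-Analysis puts on matrices is the entrywise maximum;
   the operator norm is taken with respect to the Euclidean norm. *)
Definition euclidean_norm (R : realType) (n : nat) (v : 'cV[R]_n) : R :=
  Num.sqrt (\sum_(i < n) v i 0 ^+ 2).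

Definition opnorm (R : realType) (n : nat) (A : 'M[R]_n) : R :=
  sup [set euclidean_norm (A *m v) | v in
         [set v : 'cV[R]_n | euclidean_norm v <= 1]].

(* The supremum of the finite set of real eigenvalues is the largest one
   whenever there is one; it is only used for matrices similar to a symmetric
   matrix, which have real spectrum. *)
Definition lambda_max (R : realType) (n : nat) (A : 'M[R]_n) : R :=
  sup [set x : R | eigenvalue A x].

Section MaxDampening.
Variables (R : realType) (n : nat).
Variables (S : 'I_n -> 'M[R]_n) (gamma : 'I_n -> R).

Definition damp_Q (i : 'I_n) : 'M[R]_n := invmx ((2 * gamma i) *: S i).

(* delta_mx r r is the matrix e_r e_r^T, and *t is the Kronecker product. *)
Definition damp_K : 'M[R]_(n * n) :=
  \sum_(r < n) (tensmx (delta_mx r r) (damp_Q r)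
                + tensmx (damp_Q r) (delta_mx r r)).

(* mxtens_unindex decodes the (0-based) index i * n + j as (i, j). *)
Definition damp_L : 'M[R]_(n * n) :=
  diag_mx (\row_(k < n * n)
    (damp_Q (mxtens_unindex k).1 (mxtens_unindex k).2 (mxtens_unindex k).2
     + damp_Q (mxtens_unindex k).2 (mxtens_unindex k).1 (mxtens_unindex k).1)).

Definition max_dampening : R := 2 / lambda_max (invmx damp_L *m damp_K).

End MaxDampening.

Section GaussianSample.
Context {d : measure_display} {T : measurableType d} {R : realType}.
Variable P : probability T R.

(* Mutual independence.  The generated sigma-algebra is the Borel one, and
   letting some B s be the whole space gives the product rule for
   subfamilies. *)
Definition independent_vectors (n m : nat) (Y : 'I_m -> T -> 'cV[R]_n) : Prop :=
  forall B : 'I_m -> set 'cV[R]_n,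
    (forall s, <<s [set U : set 'cV[R]_n | open U] >> (B s)) ->
    P [set w | forall s, B s (Y s w)] = (\prod_(s < m) P (Y s @^-1` B s))%E.

(* Y ~ N(mu, S): every linear form a^T Y has law N(a^T mu, a^T S a).
   normal_prob takes a standard deviation, and at standard deviation 0 it is
   not a Dirac mass, whence the case distinction. *)
Definition normal_vector (n : nat) (Y : T -> 'cV[R]_n)
    (mu : 'cV[R]_n) (S : 'M[R]_n) : Prop :=
  (forall k, measurable_fun [set: T] (fun w => Y w k 0)) /\
  forall (a : 'cV[R]_n) (B : set R), measurable B ->
    P [set w | B ((a^T *m Y w) 0 0)] =
    if (a^T *m S *m a) 0 0 == 0 then \d_((a^T *m mu) 0 0) B
    else normal_prob ((a^T *m mu) 0 0) (Num.sqrt ((a^T *m S *m a) 0 0)) B.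

Definition iid_normal_columns (n m : nat) (X : T -> 'M[R]_(n, m))
    (mu : 'cV[R]_n) (S : 'M[R]_n) : Prop :=
  (forall s, normal_vector (fun w => col s (X w)) mu S) /\
  independent_vectors (fun s w => col s (X w)).

End GaussianSample.

Definition sample_mean (R : realType) (n m : nat) (X : 'M[R]_(n, m)) :
    'cV[R]_n :=
  m%:R^-1 *: \sum_(s < m) col s X.

Definition sample_cov (R : realType) (n m : nat) (X : 'M[R]_(n, m)) :
    'M[R]_n :=
  (m%:R - 1)^-1 *: \sum_(s < m)
    (col s X - sample_mean X) *m (col s X - sample_mean X)^T.

Definition sample_size (R : realType) (n : nat) : nat :=
  absz (Num.ceil (n%:R * ln (n%:R : R))).

(* Main.v *)
(* Write delta ~ (ln n)^(-1/2).  If every empirical covariance lies between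
   (1 - delta) Sigma and (1 + delta) Sigma in the Loewner order, then, inversion
   being antitone, the perturbed K is at most K / (1 - delta) and the perturbed
   L at least L / (1 + delta), so lambda_max, which is the smallest t with
   K <= t L, grows by a factor at most (1 + delta) / (1 - delta).

   For a fixed vector x, the Chernoff bound applied to the exponential moments
   of x^T X_s and of its square shows that
   |x^T (Sigma^ - Sigma) x| <= 3 delta x^T Sigma x fails with probability
   at most 4 exp(- m delta^2 / 16).  The integer vectors x with
   sum |x_i| <= 16 n number exp(O(n)), and control of the quadratic form on
   them controls it everywhere, because truncation to integers of a vector of
   Euclidean norm 4 sqrt n yields such an x at distance at most sqrt n.
   Since m delta^2 / n is a constant, which the choice of delta makes as large
   as needed, a union bound over the vectors and over the n samples concludes.

   A probability measure is unconstrained on non-measurable sets, so the event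
   must be shown to be measurable: positive semidefiniteness is tested on the
   countably many integer vectors. *)
Require Import Defs.
From mathcomp Require Import ring lra measurable_realfun.

Set Implicit Arguments.
Unset Strict Implicit.
Unset Printing Implicit Defensive.

Local Open Scope classical_set_scope.
Local Open Scope ring_scope.

(** * Bilinear forms and the largest generalized eigenvalue *)

Section BilinearForms.
Variable R : realType.

Definition bform n (A : 'M[R]_n) (u v : 'cV[R]_n) : R := (u^T *m A *m v) 0 0.

Definition sqnorm n (v : 'cV[R]_n) : R := \sum_(i < n) v i 0 ^+ 2.

Definition symmx n (A : 'M[R]_n) : Prop := A^T = A.

(** Unlike [posdefmx], this does not include symmetry, which [symmx] carries separately. *)
Definition psdmx n (A : 'M[R]_n) : Prop := forall v, 0 <= bform A v v.

Lemma bformE n (A : 'M[R]_n) u v :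
  bform A u v = \sum_(i < n) \sum_(j < n) u i 0 * A i j * v j 0.
Proof.
rewrite /bform mxE exchange_big /=; apply: eq_bigr => j _.
by rewrite !mxE mulr_suml; apply: eq_bigr => i _; rewrite !mxE.
Qed.

Lemma bformDl n (A : 'M[R]_n) u1 u2 v :
  bform A (u1 + u2) v = bform A u1 v + bform A u2 v.
Proof. by rewrite /bform linearD !mulmxDl mxE. Qed.

Lemma bformDr n (A : 'M[R]_n) u v1 v2 :
  bform A u (v1 + v2) = bform A u v1 + bform A u v2.
Proof. by rewrite /bform !mulmxDr mxE. Qed.

Lemma bformZl n (A : 'M[R]_n) a u v : bform A (a *: u) v = a * bform A u v.
Proof. by rewrite /bform linearZ /= -!scalemxAl mxE. Qed.

Lemma bformZr n (A : 'M[R]_n) a u v : bform A u (a *: v) = a * bform A u v.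
Proof. by rewrite /bform -!scalemxAr mxE. Qed.

Lemma bform_addmx n (A B : 'M[R]_n) u v :
  bform (A + B) u v = bform A u v + bform B u v.
Proof. by rewrite /bform mulmxDr mulmxDl mxE. Qed.

Lemma bform_oppmx n (A : 'M[R]_n) u v : bform (- A) u v = - bform A u v.
Proof. by rewrite /bform mulmxN mulNmx mxE. Qed.

Lemma bform_scalemx n a (A : 'M[R]_n) u v :
  bform (a *: A) u v = a * bform A u v.
Proof. by rewrite /bform -scalemxAr -scalemxAl mxE. Qed.

Lemma bform_sym n (A : 'M[R]_n) u v : symmx A -> bform A u v = bform A v u.
Proof.
move=> sA; rewrite !bformE exchange_big /=.
apply: eq_bigr => i _; apply: eq_bigr => j _.
by rewrite -[in LHS]sA mxE; ring.
Qed.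

Lemma bform1 n (v : 'cV[R]_n) : bform 1%:M v v = sqnorm v.
Proof.
by rewrite /bform mulmx1 mxE; apply: eq_bigr => i _; rewrite mxE expr2.
Qed.

Lemma bform_delta n (A : 'M[R]_n) i j :
  bform A (delta_mx i 0) (delta_mx j 0) = A i j.
Proof. by rewrite /bform trmx_delta -rowE -colE !mxE. Qed.

Lemma sqnorm_ge0 n (v : 'cV[R]_n) : 0 <= sqnorm v.
Proof. by apply: sumr_ge0 => i _; exact: sqr_ge0. Qed.

Lemma sqnormZ n a (v : 'cV[R]_n) : sqnorm (a *: v) = a ^+ 2 * sqnorm v.
Proof. by rewrite -!bform1 bformZl bformZr mulrA expr2. Qed.

Lemma sqnorm_gt0 n (v : 'cV[R]_n) : (0 < sqnorm v) = (v != 0).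
Proof.
rewrite lt_def sqnorm_ge0 andbT; congr (~~ _).
apply/eqP/eqP => [v0|->]; last first.
  by rewrite /sqnorm big1// => i _; rewrite mxE expr0n.
apply/colP => i; rewrite mxE; apply/eqP; rewrite -sqrf_eq0; apply/eqP.
by apply: (psumr_eq0P _ v0) => // j _; exact: sqr_ge0.
Qed.

(** The form is nonnegative on the span of [u] and [v]. Its value at [c u - b v] is [c (a c - b^2)],
    which settles the case [c > 0]. No definiteness is required, so the case [c = 0] is treated
    apart. *)
Lemma bform_psd_CS n (A : 'M[R]_n) u v : symmx A -> psdmx A ->
  bform A u v ^+ 2 <= bform A u u * bform A v v.
Proof.
move=> sA pA; set a := bform A u u; set b := bform A u v; set c := bform A v v.
have q x y : 0 <= x ^+ 2 * a + 2 * x * y * b + y ^+ 2 * c.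
  have := pA (x *: u + y *: v).
  rewrite !(bformDl, bformDr, bformZl, bformZr) (bform_sym v u)// -/a -/b -/c.
  by congr (_ <= _); ring.
have c0 : 0 <= c by exact: pA.
have a0 : 0 <= a by exact: pA.
have [c00|cn0] := eqVneq c 0.
  have [->|bn0] := eqVneq b 0; first by rewrite expr0n mulr_ge0.
  (* With [c = 0] the form is affine in [y]; if [b] were nonzero, this [y] would give it the value
     -1. *)
  have := q 1 (- (a + 1) / (2 * b)); rewrite c00 mulr0 addr0.
  have -> : 1 ^+ 2 * a + 2 * 1 * (- (a + 1) / (2 * b)) * b = - 1 by field.
  by rewrite lerNr oppr0 ler10.
have cp : 0 < c by rewrite lt_def cn0.
have := q c (- b).
have -> : c ^+ 2 * a + 2 * c * - b * b + (- b) ^+ 2 * c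
       = c * (a * c - b ^+ 2) by ring.
by rewrite pmulr_rge0// subr_ge0.
Qed.

Lemma posdef_psd n (A : 'M[R]_n) : posdefmx A -> psdmx A.
Proof.
move=> [_ pA] v; have [->|/pA/ltW//] := eqVneq v 0.
by rewrite /bform mulmx0 mxE.
Qed.

(** Cauchy-Schwarz against each basis vector: an isotropic vector of a semidefinite form lies in its
    radical. *)
Lemma psd_bform0 n (A : 'M[R]_n) v : symmx A -> psdmx A ->
  bform A v v = 0 -> A *m v = 0.
Proof.
move=> sA pA v0; apply/colP => i; rewrite [RHS]mxE.
have /eqP : bform A (delta_mx i 0) v = 0.
  apply/eqP; rewrite -sqrf_eq0 eq_le sqr_ge0 andbT.
  by rewrite (le_trans (bform_psd_CS _ _ sA pA))// v0 mulr0.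
by rewrite /bform trmx_delta -mulmxA -rowE mxE => /eqP.
Qed.

Lemma psd_unit_posdef n (A : 'M[R]_n) : symmx A -> psdmx A -> A \in unitmx ->
  posdefmx A.
Proof.
move=> sA pA uA; split=> // v vn0; rewrite lt_def pA andbT.
apply: contra vn0 => /eqP/(psd_bform0 sA pA) Av0.
by rewrite -(mulKmx uA v) Av0 mulmx0.
Qed.

Lemma posdef_unit n (A : 'M[R]_n) : posdefmx A -> A \in unitmx.
Proof.
move=> [sA pA]; rewrite -row_free_unit -kermx_eq0; apply/eqP/row_matrixP => i.
rewrite row0; apply/eqP; rewrite -[_ == _]negbK; apply/negP => kn0.
have kA : row i (kermx A) *m A = 0 by rewrite -row_mul mulmx_ker row0.
have := pA (row i (kermx A))^T; rewrite trmxK kA mul0mx mxE ltxx => H.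
apply: notF; apply: H; apply: contra kn0 => /eqP/(congr1 trmx).
by rewrite trmxK => ->; rewrite trmx0.
Qed.

Lemma symmx_inv n (A : 'M[R]_n) : symmx A -> symmx (invmx A).
Proof. by move=> sA; rewrite /symmx trmx_inv sA. Qed.

Lemma bform_inv n (A : 'M[R]_n) v : posdefmx A ->
  bform A (invmx A *m v) (invmx A *m v) = bform (invmx A) v v.
Proof.
move=> pA; have uA := posdef_unit pA; have sA : symmx A := pA.1.
rewrite /bform trmx_mul (symmx_inv sA) -[_ *m invmx A *m A]mulmxA.
by rewrite mulVmx// mulmx1 mulmxA.
Qed.

Lemma posdef_inv n (A : 'M[R]_n) : posdefmx A -> posdefmx (invmx A).
Proof.
move=> pA; apply: psd_unit_posdef; first exact: symmx_inv pA.1.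
  by move=> v; rewrite -bform_inv//; exact: posdef_psd.
by rewrite unitmx_inv posdef_unit.
Qed.

Lemma posdefZ n a (A : 'M[R]_n) : 0 < a -> posdefmx A -> posdefmx (a *: A).
Proof.
move=> a0 [sA pA]; split=> [|v v0]; first by rewrite linearZ /= sA.
by rewrite -[X in 0 < X]/(bform _ _ _) bform_scalemx mulr_gt0//; exact: pA.
Qed.

Lemma bform_invr n (A : 'M[R]_n) u v : posdefmx A ->
  bform A u (invmx A *m v) = bform 1%:M u v.
Proof.
by move=> pA; rewrite /bform mulmx1 -!mulmxA mulKVmx// posdef_unit.
Qed.

(** A crude substitute for a norm, used where only the existence of a finite bound matters. *)
Definition entry_sum n (A : 'M[R]_n) : R := \sum_(i < n) \sum_(j < n) `|A i j|.

Lemma entry_sum_ge0 n (A : 'M[R]_n) : 0 <= entry_sum A.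
Proof. by apply: sumr_ge0 => i _; apply: sumr_ge0 => j _. Qed.

Lemma bform_entry_bound n (A : 'M[R]_n) (v : 'cV[R]_n) : 
  `|bform A v v| <= entry_sum A * sqnorm v.
Proof.
rewrite bformE (le_trans (ler_norm_sum _ _ _))// mulr_suml ler_sum// => i _.
rewrite (le_trans (ler_norm_sum _ _ _))// mulr_suml ler_sum// => j _.
rewrite !normrM mulrAC mulrC ler_wpM2l//.
have sqle k : `|v k 0| ^+ 2 <= sqnorm v.
  rewrite real_normK ?num_real// /sqnorm (bigD1 k)//= lerDl.
  by apply: sumr_ge0 => *; exact: sqr_ge0.
have := sqr_ge0 (`|v i 0| - `|v j 0|); have := sqle i; have := sqle j.
rewrite sqrrB; lra.
Qed.

(** Cauchy-Schwarz for [A] between [v] and [A^-1 v] gives [|v|^4 <= A(v,v) A^-1(v,v)], and the last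
    factor is at most a constant times [|v|^2]. This takes the place of a compactness argument. *)
Lemma posdef_coercive n (A : 'M[R]_n) : posdefmx A ->
  exists2 c : R, 0 < c & forall v, c * sqnorm v <= bform A v v.
Proof.
move=> pA; have pV := posdef_inv pA; set B := entry_sum (invmx A) + 1.
have B0 : 0 < B by rewrite ltr_wpDl// entry_sum_ge0.
exists B^-1; rewrite ?invr_gt0// => v; rewrite mulrC ler_pdivrMr//.
have [v0|vn0] := eqVneq v 0.
  rewrite v0 -bform1 /bform !mulmx0 !mxE mul0r; lra.
have s0 : 0 < sqnorm v by rewrite sqnorm_gt0.
rewrite -(ler_pM2l s0) -expr2.
have := bform_psd_CS v (invmx A *m v) pA.1 (posdef_psd pA).
rewrite bform_inv// bform_invr// bform1 => /le_trans; apply.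
rewrite mulrCA ler_wpM2l//; first exact: posdef_psd.
rewrite mulrC (le_trans (ler_norm _))// (le_trans (bform_entry_bound _ _))//.
by rewrite ler_pM2r// lerDl.
Qed.

(** Cauchy-Schwarz for [S] between [T^-1 v] and [S^-1 v] gives [q^2 <= S(T^-1 v, T^-1 v) p]. By
    hypothesis [a S(T^-1 v, T^-1 v) <= q], so [a q^2 <= q p], and [q] cancels. *)
Lemma bform_inv_antitone n (S T : 'M[R]_n) (a : R) : 0 < a ->
  posdefmx S -> posdefmx T ->
  (forall v, a * bform S v v <= bform T v v) ->
  forall v, a * bform (invmx T) v v <= bform (invmx S) v v.
Proof.
move=> a0 pS pT ST v; set q := bform (invmx T) v v; set p := bform (invmx S) v v.
have p0 : 0 <= p by exact/posdef_psd/posdef_inv.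
have q0 : 0 <= q by exact/posdef_psd/posdef_inv.
have CS := bform_psd_CS (invmx T *m v) (invmx S *m v) pS.1 (posdef_psd pS).
have E : bform S (invmx T *m v) (invmx S *m v) = q.
  rewrite bform_invr// /bform mulmx1 trmx_mul (symmx_inv pT.1).
  by rewrite /q /bform.
have := ST (invmx T *m v); rewrite bform_inv// -/q => STq.
rewrite E bform_inv// -/p in CS.
have [->|qn0] := eqVneq q 0; first by rewrite mulr0.
have qp : 0 < q by rewrite lt_def qn0.
rewrite -(ler_pM2l qp); rewrite mulrCA -expr2.
apply: (@le_trans _ _ (a * (bform S (invmx T *m v) (invmx T *m v) * p))).
  by rewrite ler_pM2l.
by rewrite mulrA ler_wpM2r.
Qed.

Lemma eigenvalue_bform n (K L : 'M[R]_n) x : posdefmx L ->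
  eigenvalue (invmx L *m K) x ->
  exists2 v, v != 0 & bform K v v = x * bform L v v.
Proof.
move=> pL /eigenvalueP[v vM vn0]; have uL := posdef_unit pL.
(* Eigenvectors are row vectors acting from the left: [u = v L^-1] satisfies [u K = x u L]. *)
exists (v *m invmx L)^T.
  apply: contra vn0 => /eqP/(congr1 trmx); rewrite trmxK trmx0 => u0.
  by rewrite -(mulmxKV uL v) u0 mul0mx.
rewrite /bform trmxK -[v *m _ *m K]mulmxA vM mulmxKV//.
by rewrite -!scalemxAl mxE.
Qed.

(* At the supremum t of the Rayleigh quotients t L - K is positive semidefinite;
   were it invertible, it would be coercive and t could be decreased. *)
Lemma lambda_max_spec n (K L : 'M[R]_n) : (0 < n)%N -> symmx K -> posdefmx L ->
  eigenvalue (invmx L *m K) (lambda_max (invmx L *m K)) /\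
  forall v, bform K v v <= lambda_max (invmx L *m K) * bform L v v.
Proof.
move=> n0 sK pL; set M := invmx L *m K.
have uL := posdef_unit pL.
have LP v : v != 0 -> 0 < bform L v v by exact: pL.2.
have [c c0 cL] := posdef_coercive pL.
pose E := [set bform K v v / bform L v v | v in [set v : 'cV[R]_n | v != 0]].
have En0 : E !=set0.
  exists (bform K (delta_mx (Ordinal n0) 0) (delta_mx (Ordinal n0) 0)
    / bform L (delta_mx (Ordinal n0) 0) (delta_mx (Ordinal n0) 0)).
  exists (delta_mx (Ordinal n0) 0) => //=.
  by apply/negP => /eqP/colP/(_ (Ordinal n0))/eqP; rewrite !mxE !eqxx oner_eq0.
have Eub : has_sup E.
  split => //; exists (entry_sum K / c) => _ [v vn0 <-].
  rewrite ler_pdivrMr ?LP// mulrAC ler_pdivlMr//.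
  rewrite (@le_trans _ _ (entry_sum K * sqnorm v * c))//.
    by rewrite ler_pM2r// (le_trans (ler_norm _))// bform_entry_bound.
  by rewrite -mulrA ler_wpM2l ?entry_sum_ge0// mulrC.
set t := sup E.
have KtL v : bform K v v <= t * bform L v v.
  have [->|vn0] := eqVneq v 0; first by rewrite /bform !mulmx0 !mxE mulr0.
  by rewrite -ler_pdivrMr ?LP//; apply: sup_upper_bound => //; exists v.
pose A := t *: L - K.
have bA v : bform A v v = t * bform L v v - bform K v v.
  by rewrite bform_addmx bform_oppmx bform_scalemx.
have sA : symmx A by rewrite /symmx linearB linearZ /= pL.1 sK.
have pA : psdmx A by move=> v; rewrite bA subr_ge0.
have nuA : A \notin unitmx.
  apply/negP => uA; have [a a0 aA] := posdef_coercive (psd_unit_posdef sA pA uA).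
  set b := entry_sum L + 1.
  have b0 : 0 < b by rewrite ltr_wpDl// entry_sum_ge0.
  have : t <= t - a / b.
    apply: sup_le_ub => // _ [v vn0 <-].
    have s0 : 0 < sqnorm v by rewrite sqnorm_gt0.
    rewrite ler_pdivrMr ?LP// mulrBl.
    have := aA v; rewrite bA.
    suff : a / b * bform L v v <= a * sqnorm v by lra.
    rewrite mulrAC ler_pdivrMr// -mulrA ler_pM2l// mulrC.
    rewrite (le_trans (ler_norm _))// (le_trans (bform_entry_bound _ _))//.
    by rewrite ler_pM2r// lerDl.
  have : 0 < a / b by rewrite divr_gt0.
  lra.
have Et : eigenvalue M t.
  have : kermx A != 0 by rewrite kermx_eq0 row_free_unit.
  case/rowV0Pn => u /sub_kermxP uA un0.
  apply/eigenvalueP; exists (u *m L); last first.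
    apply: contra un0 => /eqP uL0.
    by rewrite -(mulmxK uL u) uL0 mul0mx.
  rewrite /M mulmxA mulmxK//.
  move: uA; rewrite mulmxBr -scalemxAr => /eqP; rewrite subr_eq0 => /eqP.
  by move=> ->.
have lt : ubound [set x | eigenvalue M x] t.
  move=> x /(eigenvalue_bform pL)[v vn0 e].
  by have := KtL v; rewrite e ler_pM2r// LP.
suff -> : lambda_max M = t by split.
apply/eqP; rewrite eq_le; apply/andP; split.
  by apply: sup_le_ub => //; exists t.
by apply: sup_upper_bound => //; split; [exists t|exists t].
Qed.

(** For the converse, the inequality is tested at an eigenvector of the largest eigenvalue, where
    [K(v,v) = lambda L(v,v)]. *)
Lemma lambda_max_leP n (K L : 'M[R]_n) t : (0 < n)%N -> symmx K -> posdefmx L ->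
  lambda_max (invmx L *m K) <= t <->
  forall v, bform K v v <= t * bform L v v.
Proof.
move=> n0 sK pL; have [ev le] := lambda_max_spec n0 sK pL.
have LP v : v != 0 -> 0 < bform L v v by exact: pL.2.
split => [lt v|H].
  rewrite (le_trans (le v))// ler_wpM2r//; exact: posdef_psd.
have [v vn0 e] := eigenvalue_bform pL ev.
by have := H v; rewrite e ler_pM2r// LP.
Qed.

End BilinearForms.

(** * Perturbation of the maximum dampening factor *)

Section Dampening.
Variable R : realType.

Lemma bform_summx n (I : finType) (A : I -> 'M[R]_n) u v :
  bform (\sum_i A i) u v = \sum_i bform (A i) u v.
Proof. by rewrite /bform mulmx_sumr mulmx_suml summxE. Qed.

Lemma sum_mxtens n (F : 'I_(n * n) -> R) :
  \sum_k F k = \sum_(i < n) \sum_(j < n) F (mxtens_index (i, j)).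
Proof.
rewrite pair_big /= (reindex (@mxtens_index n n)) /=; last first.
  exists (@mxtens_unindex n n) => x _; [exact: mxtens_indexK|exact: mxtens_unindexK].
by apply: eq_bigr => -[].
Qed.

Lemma bform_tens n (A B : 'M[R]_n) (v : 'cV[R]_(n * n)) :
  bform (tensmx A B) v v = \sum_(i < n) \sum_(j < n)
   A i j * bform B (\col_k v (mxtens_index (i, k)) 0) (\col_k v (mxtens_index (j, k)) 0).
Proof.
rewrite bformE sum_mxtens; apply: eq_bigr => i _.
under eq_bigr do rewrite sum_mxtens.
rewrite exchange_big /=; apply: eq_bigr => j _.
rewrite bformE mulr_sumr; apply: eq_bigr => k _.
rewrite mulr_sumr; apply: eq_bigr => l _.
rewrite tensmxE !mxE; ring.
Qed.

Lemma bform_tens_deltal n (Q : 'M[R]_n) r (v : 'cV[R]_(n * n)) :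
  bform (tensmx (delta_mx r r) Q) v v =
  bform Q (\col_k v (mxtens_index (r, k)) 0) (\col_k v (mxtens_index (r, k)) 0).
Proof.
rewrite bform_tens (bigD1 r)//= (bigD1 r)//= mxE !eqxx mul1r.
rewrite big1 ?addr0 => [|j /negPf jr]; last by rewrite mxE jr andbF mul0r.
rewrite big1 ?addr0// => i /negPf ir; rewrite big1// => j _.
by rewrite mxE ir mul0r.
Qed.

Lemma bform_tens_deltar n (Q : 'M[R]_n) r (v : 'cV[R]_(n * n)) :
  bform (tensmx Q (delta_mx r r)) v v =
  bform Q (\col_k v (mxtens_index (k, r)) 0) (\col_k v (mxtens_index (k, r)) 0).
Proof.
rewrite bform_tens bformE; apply: eq_bigr => i _; apply: eq_bigr => j _.
rewrite bformE (bigD1 r)//= (bigD1 r)//= !mxE !eqxx.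
rewrite big1 ?addr0 => [|k /negPf kr]; last by rewrite !mxE kr andbF mulr0 mul0r.
rewrite big1 ?addr0 => [|k /negPf kr].
  by rewrite mulr1 mulrCA mulrA.
by rewrite big1// => l _; rewrite !mxE kr mulr0 mul0r.
Qed.

Variable n : nat.
Implicit Types (S : 'I_n -> 'M[R]_n) (gamma : 'I_n -> R).

(** With [v] read as an n by n matrix, each [Q_r] is evaluated on the r-th row and on the r-th
    column. Loewner bounds on the [Q_r] thus pass to [K] term by term; the next lemma does the same
    for [L]. *)
Lemma bform_damp_K S gamma v : bform (damp_K S gamma) v v =
  \sum_r (bform (damp_Q S gamma r) (\col_k v (mxtens_index (r, k)) 0)
            (\col_k v (mxtens_index (r, k)) 0) +
          bform (damp_Q S gamma r) (\col_k v (mxtens_index (k, r)) 0)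
            (\col_k v (mxtens_index (k, r)) 0)).
Proof.
rewrite bform_summx; apply: eq_bigr => r _.
by rewrite bform_addmx bform_tens_deltal bform_tens_deltar.
Qed.

Lemma bform_damp_L S gamma v : bform (damp_L S gamma) v v =
  \sum_k (damp_Q S gamma (mxtens_unindex k).1
            (mxtens_unindex k).2 (mxtens_unindex k).2
     + damp_Q S gamma (mxtens_unindex k).2
         (mxtens_unindex k).1 (mxtens_unindex k).1) * v k 0 ^+ 2.
Proof.
rewrite bformE; apply: eq_bigr => k _; rewrite (bigD1 k)//= big1 ?addr0.
  rewrite !mxE eqxx mulr1n; ring.
by move=> j; rewrite eq_sym !mxE => /negPf ->; rewrite mulr0n mulr0 mul0r.
Qed.

Lemma damp_Q_posdef S gamma r : 0 < gamma r -> posdefmx (S r) ->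
  posdefmx (damp_Q S gamma r).
Proof. by move=> g0 pS; apply/posdef_inv/posdefZ => //; rewrite mulr_gt0. Qed.

Lemma posdef_diag_gt0 m (A : 'M[R]_m) i : posdefmx A -> 0 < A i i.
Proof.
move=> pA; rewrite -bform_delta; apply: pA.2.
by apply/eqP => /colP/(_ i)/eqP; rewrite !mxE !eqxx oner_eq0.
Qed.

Section PosDef.
Variables (S : 'I_n -> 'M[R]_n) (gamma : 'I_n -> R).
Hypotheses (gamma_gt0 : forall r, 0 < gamma r)
  (pS : forall r, posdefmx (S r)).

Lemma damp_K_sym : symmx (damp_K S gamma).
Proof.
rewrite /symmx /damp_K linear_sum /=; apply: eq_bigr => r _.
have [sQ _] := damp_Q_posdef (gamma_gt0 r) (pS r).
by rewrite linearD /= !trmx_tens trmx_delta sQ.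
Qed.

Lemma damp_L_posdef : posdefmx (damp_L S gamma).
Proof.
have pQ r := damp_Q_posdef (gamma_gt0 r) (pS r).
split; first by rewrite tr_diag_mx.
move=> v vn0; rewrite -[X in 0 < X]/(bform _ _ _) bform_damp_L.
have [k vk0] : exists k, v k 0 != 0.
  by apply/existsP; apply: contraR vn0; rewrite negb_exists => /forallP H;
     apply/eqP/colP => k; rewrite mxE; apply/eqP; rewrite -[_ == _]negbK.
have q i j : 0 < damp_Q S gamma i j j + damp_Q S gamma j i i.
  by rewrite addr_gt0//; exact: posdef_diag_gt0.
rewrite (bigD1 k)//= ltr_pwDl//; first by rewrite mulr_gt0// exprn_even_gt0.
by apply: sumr_ge0 => j _; rewrite mulr_ge0 ?sqr_ge0// ltW.
Qed.

(* The diagonals of K and L agree, so a coordinate vector is a test vector. *)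
Lemma lambda_max_damp_ge1 : (0 < n)%N ->
  1 <= lambda_max (invmx (damp_L S gamma) *m damp_K S gamma).
Proof.
move=> n0; have nn0 : (0 < n * n)%N by rewrite muln_gt0 n0.
have [_ /(_ (delta_mx (mxtens_index (Ordinal n0, Ordinal n0)) 0))] :=
  lambda_max_spec nn0 damp_K_sym damp_L_posdef.
set k := mxtens_index _.
have -> : bform (damp_K S gamma) (delta_mx k 0) (delta_mx k 0) =
          bform (damp_L S gamma) (delta_mx k 0) (delta_mx k 0).
  rewrite !bform_delta [RHS]mxE eqxx mulr1n mxE /k mxtens_indexK /damp_K summxE.
  have E r : (tensmx (delta_mx r r) (damp_Q S gamma r) +
      tensmx (damp_Q S gamma r) (delta_mx r r)) k k =
      (r == Ordinal n0)%:R * (damp_Q S gamma r (Ordinal n0) (Ordinal n0) *+ 2).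
    by rewrite [LHS]mxE !tensmxE mxE eq_sym andbb mulr2n mulrDr [X in _ + X]mulrC.
  under eq_bigr do rewrite E.
  rewrite (bigD1 (Ordinal n0))//= mul1r mulr2n big1 ?addr0// => r /negPf ->.
  by rewrite mul0r.
rewrite -{1}[bform (damp_L _ _) _ _]mul1r ler_pM2r//.
by rewrite bform_delta; exact: posdef_diag_gt0 damp_L_posdef.
Qed.

End PosDef.

Lemma damp_Q_antitone S S' gamma a r : 0 < gamma r -> 0 < a ->
  posdefmx (S r) -> posdefmx (S' r) ->
  (forall v, a * bform (S r) v v <= bform (S' r) v v) ->
  forall v, a * bform (damp_Q S' gamma r) v v <= bform (damp_Q S gamma r) v v.
Proof.
move=> g0 a0 pS pS' SS'; have g20 : 0 < 2 * gamma r by rewrite mulr_gt0.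
apply: bform_inv_antitone => //; [exact: posdefZ|exact: posdefZ|].
by move=> v; rewrite !bform_scalemx mulrCA ler_pM2l.
Qed.

Lemma max_dampening_perturb S S' gamma (d : R) : (0 < n)%N ->
  (forall r, 0 < gamma r) -> 0 < d < 1 ->
  (forall r, posdefmx (S r)) -> (forall r, posdefmx (S' r)) ->
  (forall r v, (1 - d) * bform (S r) v v <= bform (S' r) v v) ->
  (forall r v, bform (S' r) v v <= (1 + d) * bform (S r) v v) ->
  (1 - 2 * d) * max_dampening S gamma <= max_dampening S' gamma.
Proof.
move=> n0 g0 /andP[d0 d1] pS pS' lo hi.
have d1' : 0 < 1 - d by lra.
have dp : 0 < 1 + d by lra.
have Qlo r := damp_Q_antitone (g0 r) d1' (pS r) (pS' r) (lo r).
(* The same antitonicity with [S] and [S'] exchanged and factor [1 / (1 + d)]. *)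
have Qhi r v : bform (damp_Q S gamma r) v v <= (1 + d) * bform (damp_Q S' gamma r) v v.
  rewrite -ler_pdivrMl//; apply: damp_Q_antitone => //; first by rewrite invr_gt0.
  by move=> w; rewrite ler_pdivrMl.
rewrite /max_dampening.
set l := lambda_max (invmx (damp_L S gamma) *m _).
set l' := lambda_max (invmx (damp_L S' gamma) *m _).
have l1 : 1 <= l by exact: lambda_max_damp_ge1.
have l1' : 1 <= l' by exact: lambda_max_damp_ge1.
have nn0 : (0 < n * n)%N by rewrite muln_gt0 n0.
have ll' : l' <= (1 + d) / (1 - d) * l.
  apply/lambda_max_leP => //; [exact: damp_K_sym|exact: damp_L_posdef|] => v.
  have [_ /(_ v)] := lambda_max_spec nn0 (damp_K_sym g0 pS) (damp_L_posdef g0 pS).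
  rewrite -/l => KL.
  have KK : (1 - d) * bform (damp_K S' gamma) v v <= bform (damp_K S gamma) v v.
    rewrite !bform_damp_K mulr_sumr ler_sum// => r _.
    by rewrite mulrDr lerD.
  have LL : bform (damp_L S gamma) v v <= (1 + d) * bform (damp_L S' gamma) v v.
    rewrite !bform_damp_L mulr_sumr ler_sum// => k _.
    rewrite mulrA ler_wpM2r ?sqr_ge0// mulrDr lerD//.
      by have := Qhi (mxtens_unindex k).1 (delta_mx (mxtens_unindex k).2 0); rewrite !bform_delta.
    by have := Qhi (mxtens_unindex k).2 (delta_mx (mxtens_unindex k).1 0); rewrite !bform_delta.
  rewrite -(ler_pM2l d1') (le_trans KK)// (le_trans KL)//.
  have -> : (1 - d) * ((1 + d) / (1 - d) * l * bform (damp_L S' gamma) v v)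
    = l * ((1 + d) * bform (damp_L S' gamma) v v) by field; rewrite gt_eqF.
  by rewrite ler_pM2l; [exact: LL|exact: lt_le_trans l1].
clearbody l l'.
have lp : 0 < l by lra.
have lp' : 0 < l' by lra.
rewrite ler_pdivlMr// mulrC !mulrA ler_pdivrMr//.
(* For [d >= 1/2] the claimed lower bound is nonpositive. Otherwise the bound on [l'] suffices,
   since [(1 - d) - (1 + d)(1 - 2 d) = 2 d^2]. *)
have [d2|d2] := leP (1 - 2 * d) 0.
  have : l' * (1 - 2 * d) <= 0 by rewrite pmulr_rle0.
  nra.
have : l' * (1 - 2 * d) <= (1 + d) / (1 - d) * l * (1 - 2 * d) by rewrite ler_pM2r.
suff : (1 + d) / (1 - d) * l * (1 - 2 * d) <= l by lra.
have -> : (1 + d) / (1 - d) * l * (1 - 2 * d) = (1 + d) * (1 - 2 * d) * l / (1 - d).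
  by field; rewrite gt_eqF.
rewrite ler_pdivrMr// -subr_ge0.
have -> : l * (1 - d) - (1 + d) * (1 - 2 * d) * l = 2 * d ^+ 2 * l by ring.
by rewrite mulr_ge0 ?(ltW lp)// mulr_ge0// sqr_ge0.
Qed.

End Dampening.

(** * Operator norm and integer nets *)

Section OpnormNet.
Variable R : realType.

Lemma symmx1 n : symmx (1%:M : 'M[R]_n).
Proof. by rewrite /symmx trmx1. Qed.

Lemma psdmx1 n : psdmx (1%:M : 'M[R]_n).
Proof. by move=> v; rewrite bform1 sqnorm_ge0. Qed.

Lemma euclidean_norm_sqr n (v : 'cV[R]_n) : euclidean_norm v ^+ 2 = sqnorm v.
Proof. by rewrite sqr_sqrtr// sqnorm_ge0. Qed.

Lemma euclidean_norm_ge0 n (v : 'cV[R]_n) : 0 <= euclidean_norm v.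
Proof. exact: sqrtr_ge0. Qed.

(** The real [sup] is meaningful only for nonempty bounded sets. Boundedness holds because the
    entries of a vector in the unit ball are at most 1 in absolute value. *)
Lemma opnorm_has_sup n (A : 'M[R]_n) :
  has_sup [set euclidean_norm (A *m v) | v in
         [set v : 'cV[R]_n | euclidean_norm v <= 1]].
Proof.
split.
  exists (euclidean_norm (A *m 0)); exists 0 => //=.
  by rewrite /euclidean_norm big1 ?sqrtr0// => i _; rewrite mxE expr0n.
exists (Num.sqrt (\sum_i (\sum_j `|A i j|) ^+ 2)) => _ [v /= v1 <-].
apply: ler_wsqrtr; apply: ler_sum => i _.
rewrite -[leLHS]real_normK ?num_real// ler_sqr ?nnegrE//; last exact: sumr_ge0.
rewrite mxE (le_trans (ler_norm_sum _ _ _))// ler_sum// => j _.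
rewrite normrM ler_piMr//.
have : `|v j 0| ^+ 2 <= 1.
  rewrite real_normK ?num_real//.
  have : sqnorm v <= 1 by rewrite -euclidean_norm_sqr expr_le1// euclidean_norm_ge0.
  apply: le_trans; rewrite /sqnorm (bigD1 j)//= lerDl.
  by apply: sumr_ge0 => *; exact: sqr_ge0.
by rewrite expr_le1.
Qed.

(** After normalizing [v] to a unit vector [u], Cauchy-Schwarz for the Euclidean product bounds
    [u^T A u] by the length of [A u]. *)
Lemma bform_opnorm n (A : 'M[R]_n) v : `|bform A v v| <= opnorm A * sqnorm v.
Proof.
have [->|vn0] := eqVneq v 0.
  by rewrite -bform1 /bform !mulmx0 mxE normr0 mulr0.
have s0 : 0 < sqnorm v by rewrite sqnorm_gt0.
have e0 : 0 < euclidean_norm v by rewrite sqrtr_gt0.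
set u := (euclidean_norm v)^-1 *: v.
have u1 : sqnorm u = 1.
  by rewrite sqnormZ exprVn euclidean_norm_sqr mulVf// gt_eqF.
have le : euclidean_norm (A *m u) <= opnorm A.
  apply: sup_upper_bound; first exact: opnorm_has_sup.
  exists u => //=; suff -> : euclidean_norm u = 1 by [].
  by rewrite /euclidean_norm -/(sqnorm u) u1 sqrtr1.
have op0 := le_trans (euclidean_norm_ge0 _) le.
have -> : bform A v v = sqnorm v * bform A u u.
  rewrite bformZl bformZr [_^-1 * (_ * _)]mulrA -expr2 exprVn euclidean_norm_sqr mulrA.
  by rewrite mulfV ?mul1r// gt_eqF.
rewrite normrM gtr0_norm// mulrC ler_pM2r//.
have := bform_psd_CS u (A *m u) (@symmx1 n) (@psdmx1 n).
rewrite !bform1 u1 mul1r.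
have -> : bform 1%:M u (A *m u) = bform A u u by rewrite /bform mulmx1 mulmxA.
rewrite -euclidean_norm_sqr -[leLHS]real_normK ?num_real//.
rewrite ler_sqr ?nnegrE ?euclidean_norm_ge0// => /le_trans; exact.
Qed.

(** The coercivity argument again, with the operator norm of the inverse as explicit constant: a
    lower bound on the spectrum of [A] without diagonalization. *)
Lemma bform_opnorm_inv n (A : 'M[R]_n) v : posdefmx A ->
  sqnorm v <= opnorm (invmx A) * bform A v v.
Proof.
move=> pA.
have [->|vn0] := eqVneq v 0.
  by rewrite -bform1 /bform !mulmx0 mxE mulr0.
have s0 : 0 < sqnorm v by rewrite sqnorm_gt0.
rewrite -(ler_pM2l s0) -expr2.
have := bform_psd_CS v (invmx A *m v) pA.1 (posdef_psd pA).
rewrite bform_inv// bform_invr// bform1 => /le_trans; apply.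
rewrite mulrA [leRHS]mulrC ler_wpM2l//; first exact: posdef_psd.
by rewrite [leRHS]mulrC (le_trans (ler_norm _))// bform_opnorm.
Qed.

(** Integer vectors are coded by sign and magnitude in a finite type, over which a union bound can
    be summed. Zero entries have two codes, which only enlarges the count. *)
Definition net_vector n N (f : {ffun 'I_n -> bool * 'I_N.+1}) : 'cV[R]_n :=
  \col_i ((-1) ^+ (f i).1 * ((f i).2 : nat)%:R).

(** It is the bound on the sum of the magnitudes that keeps the cardinality exponential in [n] when
    [N] is a multiple of [n]. *)
Definition net n N : {set {ffun 'I_n -> bool * 'I_N.+1}} :=
  [set f : {ffun 'I_n -> bool * 'I_N.+1} | (\sum_i (f i).2 <= N)%N]%SET.

(** Give each code the weight [2^-(sum of magnitudes)]. On the net, [2^N] times the weight is at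
    least 1, while the total weight is a product of [n] equal factors, each at most 4: two signs
    times a geometric sum below 2. *)
Lemma card_net n N : (#|net n N|%:R : R) <= 2 ^+ N * 4 ^+ n.
Proof.
pose w (f : {ffun 'I_n -> bool * 'I_N.+1}) : R := \prod_i 2^-1 ^+ (f i).2.
have wE f : w f = 2^-1 ^+ \sum_i (f i).2.
  by rewrite /w; elim/big_rec2: _ => // i a b _ ->; rewrite exprD.
apply: (@le_trans _ _ (\sum_f 2 ^+ N * w f)).
  rewrite -sum1_card natr_sum [leRHS](bigID (mem (net n N)))/= -[leLHS]addr0.
  apply: lerD; last by apply: sumr_ge0 => f _; rewrite wE mulr_ge0// exprn_ge0.
  apply: ler_sum => f; rewrite inE => fN.
  rewrite wE exprVn -expfB_cond ?pnatr_eq0//; first by rewrite exprn_ege1 ?ler1n.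
rewrite -mulr_sumr ler_pM2l ?exprn_gt0//.
rewrite /w -(bigA_distr_bigA (fun _ (x : bool * 'I_N.+1) => 2^-1 ^+ x.2 : R)) /=.
rewrite big_const_ord iter_mulr mulr1.
apply: lerXn2r; rewrite ?nnegrE//; first by apply: sumr_ge0 => *; rewrite exprn_ge0.
rewrite -(pair_bigA _ (fun (_ : bool) (j : 'I_N.+1) => 2^-1 ^+ j : R)) /=.
rewrite big_bool /=.
have -> : \sum_(j < N.+1) (2^-1 : R) ^+ j = 2 * (1 - 2^-1 ^+ N.+1).
  by rewrite -[in RHS]opprB subrX1; field.
have : 0 <= (2^-1 : R) ^+ N.+1 by rewrite exprn_ge0.
lra.
Qed.

(** Every coordinate is truncated towards zero, so it moves by at most 1 and does not grow in
    absolute value. *)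
Lemma net_round n (T : nat) (v : 'cV[R]_n) : sqnorm v <= (T * n)%:R ->
  exists2 f, f \in net n (T * n) &
    sqnorm (v - net_vector f) <= n%:R /\ sqnorm (net_vector f) <= sqnorm v.
Proof.
move=> vT; pose t i := Num.truncn `|v i 0|.
have tle i : (t i)%:R <= `|v i 0| by rewrite truncn_le.
have tgt i : `|v i 0| < (t i)%:R + 1 by rewrite natr1 truncnS_gt.
have tsum : (\sum_i t i <= T * n)%N.
  rewrite -(ler_nat R) (le_trans _ vT)// natr_sum; apply: ler_sum => i _.
  (* [t <= t^2] for natural numbers turns the bound on squares into one on the sum of magnitudes. *)
  apply: (@le_trans _ _ ((t i)%:R ^+ 2)).
    by rewrite -natrX ler_nat -mulnn; case: (t i) => // k; rewrite leq_pmulr.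
  by rewrite -[leRHS]real_normK ?num_real// ler_sqr ?nnegrE.
have tlt i : (t i < (T * n).+1)%N.
  by rewrite ltnS (leq_trans _ tsum)// (bigD1 i)//= leq_addr.
pose f := [ffun i => (v i 0 < 0, Ordinal (tlt i))].
have fE i : net_vector f i 0 = (-1) ^+ (v i 0 < 0)%R * (t i)%:R.
  by rewrite mxE ffunE.
have vE i : v i 0 = (-1) ^+ (v i 0 < 0)%R * `|v i 0| by rewrite -numEsign.
have sg2 (b : bool) : ((-1) ^+ b : R) ^+ 2 = 1 by rewrite sqrr_sign.
exists f; first by rewrite inE; under eq_bigr do rewrite ffunE.
split.
  have -> : n%:R = \sum_(i < n) 1 :> R by rewrite sumr_const card_ord.
  apply: ler_sum => i _.
  have -> : (v - net_vector f) i 0 = (-1) ^+ (v i 0 < 0)%R * (`|v i 0| - (t i)%:R).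
    by rewrite mulrBr -vE -fE !mxE.
  rewrite exprMn sg2 mul1r expr_le1//; last by rewrite subr_ge0.
  by rewrite lerBlDl ltW// .
apply: ler_sum => i _; rewrite fE exprMn sg2 mul1r -[leRHS]real_normK ?num_real//.
by rewrite ler_sqr ?nnegrE.
Qed.

(* Polarization bounds the off-diagonal values of a symmetric form. *)
Lemma bform_polar n (A : 'M[R]_n) a s u v : symmx A -> 0 < s ->
  (forall w, `|bform A w w| <= a * sqnorm w) ->
  `|bform A u v| <= a / 2 * (s * sqnorm u + sqnorm v / s).
Proof.
move=> sA s0 H.
have e w1 w2 (B : 'M[R]_n) : symmx B -> bform B (w1 + w2) (w1 + w2) =
    bform B w1 w1 + 2 * bform B w1 w2 + bform B w2 w2.
  by move=> sB; rewrite bformDl !bformDr (bform_sym w2 w1)//; ring.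
have := H (s *: u + v); have := H (s *: u - v).
rewrite -!bform1 !e//; try exact: symmx1.
rewrite -scaleN1r !(bformZl, bformZr) !bform1 !ler_norml => /andP[h1 h2] /andP[h3 h4].
set x := bform A u v in h1 h2 h3 h4 *; set y := bform _ u v in h1 h2 h3 h4.
rewrite -ler_norml.
have -> : a / 2 * (s * sqnorm u + sqnorm v / s) =
   a * (s ^+ 2 * sqnorm u + sqnorm v) / (2 * s) by field; rewrite gt_eqF.
rewrite ler_pdivlMr ?mulr_gt0// -[X in _ * X]gtr0_norm ?mulr_gt0// -normrM ler_norml.
by apply/andP; split; lra.
Qed.

(* Rounding turns any bound a on the quadratic form into b + a / 2, so the least
   bound is at most 2 b. *)
Lemma net_bform n (A : 'M[R]_n) (b : R) : symmx A -> 0 <= b ->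
  (forall f, f \in net n (16 * n) ->
    `|bform A (net_vector f) (net_vector f)| <= b * sqnorm (net_vector f)) ->
  forall v, `|bform A v v| <= 2 * b * sqnorm v.
Proof.
move=> sA b0 H.
have [n0|n_gt0] := posnP n.
  move=> v; suff -> : v = 0.
    by rewrite /bform mulmx0 mxE normr0 mulr_ge0// ?mulr_ge0// sqnorm_ge0.
  by apply/colP => i; have := leq_trans (ltn_ord i) (eq_leq n0).
have step a : (forall v, `|bform A v v| <= a * sqnorm v) ->
    forall v, `|bform A v v| <= (b + a / 2) * sqnorm v.
  move=> Ha v.
  have [->|vn0] := eqVneq v 0; first by rewrite -bform1 /bform !mulmx0 mxE normr0 mulr0.
  have s0 : 0 < sqnorm v by rewrite sqnorm_gt0.
  have np : 0 < (16 * n)%:R :> R by rewrite ltr0n muln_gt0.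
  pose c := Num.sqrt ((16 * n)%:R / sqnorm v).
  have c2 : c ^+ 2 = (16 * n)%:R / sqnorm v by rewrite sqr_sqrtr// divr_ge0// ltW.
  have cp : 0 < c ^+ 2 by rewrite c2 divr_gt0.
  suff : `|bform A (c *: v) (c *: v)| <= (b + a / 2) * sqnorm (c *: v).
    rewrite bformZl bformZr mulrA -expr2 normrM gtr0_norm// sqnormZ mulrCA.
    by rewrite ler_pM2l.
  have : sqnorm (c *: v) = (16 * n)%:R by rewrite sqnormZ c2 mulfVK// gt_eqF.
  move: (c *: v) => {cp c2 c s0 vn0} {}v vE.
  have [|f fN [f1 f2]] := @net_round n 16 v; first by rewrite vE.
  set k := net_vector f in f1 f2.
  have a0 : 0 <= a.
    have := le_trans (normr_ge0 _) (Ha v).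
    by rewrite pmulr_lge0// vE.
  have sk : sqnorm (v + k) <= 4 * sqnorm v.
    have -> : sqnorm (v + k) = 2 * sqnorm v + 2 * sqnorm k - sqnorm (v - k).
      rewrite -!bform1 -[- k]scaleN1r !(bformDl, bformDr, bformZl, bformZr); ring.
    by have := sqnorm_ge0 (v - k); lra.
  have d : bform A v v = bform A k k + bform A (v - k) (v + k).
    rewrite -scaleN1r !(bformDl, bformDr, bformZl, bformZr) (bform_sym k v)//; ring.
  (* As [|v - k|^2 <= n] and [|v + k|^2 <= 64 n], the weight 8 makes both polarization terms at most
     [8 n]; together they are at most [16 n = |v|^2]. *)
  have s8 : (0 : R) < 8 by [].
  have := bform_polar (v - k) (v + k) sA s8 Ha.
  have := H f fN; rewrite -/k => Hk.
  have : b * sqnorm k <= b * sqnorm v by rewrite ler_wpM2l.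
  have : a / 2 * (8 * sqnorm (v - k) + sqnorm (v + k) / 8) <= a / 2 * sqnorm v.
    rewrite ler_wpM2l ?divr_ge0//.
    move: sk f1; rewrite vE natrM; lra.
  have := ler_normD (bform A k k) (bform A (v - k) (v + k)); rewrite -d mulrDl; lra.
move=> v.
have [->|vn0] := eqVneq v 0; first by rewrite -bform1 /bform !mulmx0 mxE normr0 mulr0.
pose E := [set `|bform A v v| / sqnorm v | v in [set v : 'cV[R]_n | v != 0]].
have sE : has_sup E.
  split; first by exists (`|bform A v v| / sqnorm v); exists v.
  exists (entry_sum A) => _ [w wn0 <-].
  by rewrite ler_pdivrMr ?sqnorm_gt0// bform_entry_bound.
have HE w : `|bform A w w| <= sup E * sqnorm w.
  have [->|wn0] := eqVneq w 0; first by rewrite -bform1 /bform !mulmx0 mxE normr0 mulr0.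
  by rewrite -ler_pdivrMr ?sqnorm_gt0//; apply: sup_upper_bound => //; exists w.
have : sup E <= b + sup E / 2.
  apply: sup_le_ub; first by exists (`|bform A v v| / sqnorm v); exists v.
  by move=> _ [w wn0 <-]; rewrite ler_pdivrMr ?sqnorm_gt0// step.
move=> sup2; apply: (le_trans (HE v)); rewrite ler_wpM2r ?sqnorm_ge0//; lra.
Qed.

End OpnormNet.

(** * Expectations of products of independent variables *)

Section Transfer.
Context {d d' : measure_display} {T : measurableType d} {S : measurableType d'}
  {R : realType}.
Import HBNNSimple.

(** The hypothesis says that the image under [Z] of the measure with density [G] is [c Q]. It
    extends from indicators to simple functions by linearity, and then to [h] by monotone
    convergence. It serves both to integrate against a density and to split off an independent
    factor. *)
Lemma integral_transfer (mu : {measure set T -> \bar R})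
    (Q : {measure set S -> \bar R}) (Z : T -> S) (G : T -> R) (c : R) :
  measurable_fun [set: T] Z -> measurable_fun [set: T] G ->
  (forall x, 0 <= G x) -> 0 <= c ->
  (forall B, measurable B ->
     \int[mu]_x (\1_B (Z x) * G x)%:E = c%:E * Q B)%E ->
  forall h : S -> R, measurable_fun [set: S] h -> (forall x, 0 <= h x) ->
  (\int[mu]_x (h (Z x) * G x)%:E = c%:E * \int[Q]_y (h y)%:E)%E.
Proof.
move=> mZ mG G0 c0 ind h mh h0.
have mh' : measurable_fun [set: S] (EFin \o h) by exact/measurable_EFinP.
pose f_ := nnsfun_approx measurableT mh'.
have f_cvg x : (f_ n x)%:E @[n --> \oo] --> (h x)%:E.
  by apply: (cvg_nnsfun_approx measurableT mh') => // y _; rewrite lee_fin.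
have f_nd x : {homo (fun n => f_ n x) : m n / (m <= n)%N >-> m <= n}.
  by move=> m n mn; exact/lefP/nd_nnsfun_approx.
have mfk n k : measurable (f_ n @^-1` [set k]) by [].
have mind n k : measurable_fun [set: T] (fun x => \1_(f_ n @^-1` [set k]) (Z x) : R).
  by apply: (measurableT_comp (f := \1_(f_ n @^-1` [set k]) : S -> R)).
have mf n : measurable_fun [set: T] (fun x => f_ n (Z x) * G x).
  by apply: measurable_funM => //; exact: measurableT_comp.
transitivity (limn (fun n => \int[mu]_x (f_ n (Z x) * G x)%:E)%E).
  rewrite -monotone_convergence//.
  - apply: eq_integral => x _; apply/esym/cvg_lim => //.
    apply: cvg_EFin; first by near=> n.
    by apply: cvgMr_tmp; exact: (fine_cvg (f_cvg (Z x))).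
  - by move=> n; exact/measurable_EFinP.
  - by move=> n x _; rewrite lee_fin mulr_ge0.
  - by move=> x _ m n mn; rewrite lee_fin ler_wpM2r// f_nd.
transitivity (limn (fun n => c%:E * \int[Q]_y (f_ n y)%:E)%E).
  congr (limn _); apply/funext => n.
  transitivity (\sum_(k \in range (f_ n))
      \int[mu]_x (k * (\1_(f_ n @^-1` [set k]) (Z x) * G x))%:E)%E.
    rewrite -ge0_integral_fsum//; last 2 first.
    - move=> k; apply/measurable_EFinP; apply: measurable_funM => //.
      apply: measurable_funM => //; exact: mind.
    - by move=> k x _; rewrite mulrA lee_fin mulr_ge0// -lee_fin EFinM nnfun_muleindic_ge0.
    apply: eq_integral => x _; rewrite fimfunE mulr_fsuml ?fsumEFin//.
    by congr EFin; apply: eq_fsbigr => k _; rewrite mulrA.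
  rewrite integral_nnsfun// patch_setT sintegralE.
  rewrite ge0_mule_fsumr; last first.
    (* Nonnegativity is required at every real level; negative levels of a nonnegative simple
       function have empty preimage. *)
    move=> k; have [k0|k0] := leP 0 k; first by rewrite mule_ge0// lee_fin.
    by rewrite preimage_nnfun0// measure0 mule0.
  apply: eq_fsbigr => k /[!inE] -[y _ <-].
  under eq_integral do rewrite EFinM.
  rewrite ge0_integralZl_EFin//; last 2 first.
  - by move=> x _; rewrite lee_fin mulr_ge0.
  - by apply/measurable_EFinP; apply: measurable_funM => //; exact: mind.
  by rewrite ind// muleCA.
rewrite limeMl//.
  congr (_ * _)%E; rewrite -monotone_convergence//.
  - by apply: eq_integral => x _; apply/cvg_lim => //; exact: f_cvg.
  - by move=> n; exact/measurable_EFinP.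
  - by move=> n x _; rewrite lee_fin.
  - by move=> x _ m n mn; rewrite lee_fin f_nd.
apply/ereal_nondecreasing_is_cvgn => m n mn; apply: ge0_le_integral => //.
- by move=> x _; rewrite lee_fin.
- exact/measurable_EFinP.
- exact/measurable_EFinP.
- by move=> x _; rewrite lee_fin f_nd.
Unshelve. all: by end_near. Qed.

End Transfer.

(** * Exponential moments of the normal law *)

Section Gaussian.
Variable R : realType.

Lemma integral_normal_prob (m s : R) (h : R -> R) :
  measurable_fun [set: R] h -> (forall x, 0 <= h x) ->
  (\int[normal_prob m s]_x (h x)%:E =
   \int[lebesgue_measure]_x (h x * normal_pdf m s x)%:E)%E.
Proof.
move=> mh h0; rewrite -[LHS]mul1e.
rewrite -(@integral_transfer _ _ _ _ _ lebesgue_measure (normal_prob m s) id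
  (normal_pdf m s) 1)//.
- exact: measurable_normal_pdf.
- by move=> x; exact: normal_pdf_ge0.
- move=> B mB; rewrite mul1e [RHS]integral_mkcond.
apply: eq_integral => x _; rewrite patchE indicE.
by case: ifPn => _; rewrite ?mul1r ?mul0r.
Qed.

(** Exponential tilting: if [h] turns one normal density into [c] times another, its expectation is
    [c], because the second density has integral 1. *)
Lemma integral_normal_tilt (m s m' s' c : R) (h : R -> R) :
  measurable_fun [set: R] h -> (forall x, 0 <= h x) -> 0 <= c ->
  (forall x, h x * normal_pdf m s x = c * normal_pdf m' s' x) ->
  (\int[normal_prob m s]_x (h x)%:E = c%:E)%E.
Proof.
move=> mh h0 c0 e; rewrite integral_normal_prob//.
under eq_integral do rewrite e EFinM.
rewrite ge0_integralZl_EFin//.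
- by rewrite integral_normal_pdf mule1.
- by move=> x _; rewrite lee_fin normal_pdf_ge0.
- by apply/measurable_EFinP; exact: measurable_normal_pdf.
Qed.

(** The moment generating function of a chi-squared variable with one degree of freedom: the tilt
    changes the variance [s^2] into [s^2 / (1 - 2 l)]. *)
Lemma integral_normal_sqr_exp (s l : R) : 0 < s -> l < 2^-1 ->
  (\int[normal_prob 0 s]_x (expR (l * (x / s) ^+ 2))%:E =
    ((Num.sqrt (1 - 2 * l))^-1)%:E)%E.
Proof.
move=> s0 l2; have l0 : 0 < 1 - 2 * l by lra.
set r := Num.sqrt _; have r0 : 0 < r by rewrite sqrtr_gt0.
have r2 : r ^+ 2 = 1 - 2 * l by rewrite sqr_sqrtr// ltW.
apply: (@integral_normal_tilt _ _ 0 (s / r)).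
- apply: measurableT_comp => //; apply: measurable_funM => //.
  by apply: measurable_funX; apply: measurable_funM.
- by move=> x; exact: expR_ge0.
- by rewrite invr_ge0 ltW.
move=> x; rewrite !normal_pdfE ?gt_eqF ?divr_gt0// mulrCA [RHS]mulrA.
rewrite /normal_fun -expRD subr0.
have -> : l * (x / s) ^+ 2 + - x ^+ 2 / (s ^+ 2 *+ 2) =
   - x ^+ 2 / ((s / r) ^+ 2 *+ 2).
  rewrite !exprMn !exprVn r2; field.
  by rewrite gt_eqF//= gt_eqF.
congr (_ * _); rewrite /normal_peak exprMn exprVn.
have -> : s ^+ 2 * (r ^+ 2)^-1 * pi *+ 2 = (s ^+ 2 * pi *+ 2) * (r ^+ 2)^-1.
  by rewrite mulrAC mulrnAl.
rewrite sqrtrM; last by rewrite mulrn_wge0// mulr_ge0 ?sqr_ge0// pi_ge0.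
rewrite sqrtrV ?sqr_ge0// sqrtr_sqr gtr0_norm// invfM invrK.
by rewrite mulrCA mulVf ?mulr1 ?gt_eqF.
Qed.

(** After squaring, [exp x >= 1 + x] reduces the claim to [(1 + 2 l + 8 l^2)(1 - 2 l) = 1 + 4 l^2 (1
    - 4 l) >= 1], whence the condition [l <= 1/4]. *)
Lemma sqrt_exp_le (l : R) : l <= 4^-1 ->
  (Num.sqrt (1 - 2 * l))^-1 <= expR (l + 4 * l ^+ 2).
Proof.
move=> l4; have l0 : 0 < 1 - 2 * l by lra.
set r := Num.sqrt _; have r0 : 0 < r by rewrite sqrtr_gt0.
have r2 : r ^+ 2 = 1 - 2 * l by rewrite sqr_sqrtr// ltW.
rewrite -ler_sqr ?nnegrE ?invr_ge0 ?expR_ge0 ?(ltW r0)// exprVn r2 -expRM_natl.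
rewrite -[leLHS]div1r ler_pdivrMr//.
have := expR_ge1Dx (2 * (l + 4 * l ^+ 2)) => e.
apply: (@le_trans _ _ ((1 + 2 * (l + 4 * l ^+ 2)) * (1 - 2 * l))); last by rewrite ler_pM2r.
by have := sqr_ge0 l; nra.
Qed.

(** Completing the square: the tilt moves the mean to [t s] and keeps the variance. *)
Lemma integral_normal_exp (s t : R) : 0 < s ->
  (\int[normal_prob 0 s]_x (expR (t * (x / s)))%:E = (expR (t ^+ 2 / 2))%:E)%E.
Proof.
move=> s0; apply: (@integral_normal_tilt _ _ (t * s) s).
- apply: measurableT_comp => //; apply: measurable_funM => //.
  by apply: measurable_funM.
- by move=> x; exact: expR_ge0.
- exact: expR_ge0.
move=> x; rewrite !normal_pdfE ?gt_eqF// mulrCA [RHS]mulrCA; congr (_ * _).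
rewrite /normal_fun -!expRD; congr expR; field.
by rewrite gt_eqF.
Qed.

End Gaussian.

Lemma measurable_forall d (T : measurableType d) (I : countType)
    (A : I -> set T) :
  (forall i, measurable (A i)) -> measurable [set w | forall i, A i w].
Proof.
move=> mA; rewrite (_ : [set _ | _] = ~` \bigcup_(i in [set: I]) ~` A i).
  apply: measurableC; apply: countable_bigcupT_measurable => // i.
  exact: measurableC.
rewrite setC_bigcup; apply/seteqP; split => w /= H i.
  by move=> _; rewrite setCK.
by have := H i Logic.I; rewrite setCK.
Qed.

Section IndependentProducts.
Context {d : measure_display} {T : measurableType d} {R : realType}.
Variables (P : probability T R) (m : nat) (Z : 'I_m -> T -> R).
Variable Q : probability (measurableTypeR R) R.
Hypothesis mZ : forall s, measurable_fun [set: T] (Z s).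
Hypothesis Zind : forall B : 'I_m -> set R, (forall s, measurable (B s)) ->
  P [set w | forall s, B s (Z s w)] = (\prod_(s < m) Q (B s))%E.

Lemma prodEFin (I : finType) (F : I -> R) :
  (\prod_i (F i)%:E = (\prod_i F i)%:E)%E.
Proof. by elim/big_rec2: _ => // i a b _ ->. Qed.

(* Indicators are replaced by h one variable at a time. *)
Lemma expectation_prod (h : R -> R) (M : R) :
  measurable_fun [set: R] h -> (forall x, 0 <= h x) ->
  (\int[Q]_y (h y)%:E = M%:E)%E ->
  (\int[P]_w (\prod_s h (Z s w))%:E = (M ^+ m)%:E)%E.
Proof.
move=> mh h0 hM.
have M0 : 0 <= M by rewrite -lee_fin -hM; apply: integral_ge0 => x _; rewrite lee_fin.
pose q B := fine (Q B).
have qE B : measurable B -> Q B = (q B)%:E.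
  by move=> mB; rewrite fineK// fin_num_measure.
(* The hybrid after [k] replacements; keeping the sets [B] arbitrary makes the induction work. *)
pose F k (B : 'I_m -> set R) (s : 'I_m) w : R :=
  if (s < k)%N then h (Z s w) else \1_(B s) (Z s w).
have mF k B s : measurable (B s) -> measurable_fun [set: T] (F k B s).
  move=> mB; rewrite /F; case: (s < k)%N; first exact: measurableT_comp.
  by apply: (measurableT_comp (f := \1_(B s) : R -> R)) => //; exact: measurable_indic.
have F0 k B s w : 0 <= F k B s w by rewrite /F; case: ifP.
suff H k : (k <= m)%N -> forall B, (forall s, measurable (B s)) ->
    (\int[P]_w (\prod_s F k B s w)%:E =
     (\prod_(s < m) if (s < k)%N then M else q (B s))%:E)%E.
  have := H m (leqnn m) (fun=> setT) (fun=> measurableT).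
  rewrite (eq_bigr (fun=> M)) => [|s _]; last by rewrite ltn_ord.
  rewrite prodr_const card_ord => <-.
  by apply: eq_integral => w _; congr EFin; apply: eq_bigr => s _; rewrite /F ltn_ord.
elim: k => [_ B mB|k IH km B mB].
  rewrite -prodEFin (eq_bigr (fun s => Q (B s))) => [|s _]; last by rewrite /= qE; [|exact: mB].
  rewrite -Zind// -[X in P X]setIT -integral_indic//; last first.
    apply: measurable_forall => s.
    by rewrite -[X in measurable X]setTI; exact: mZ.
  apply: eq_integral => w _; congr EFin; rewrite /F /=.
  under eq_bigr do rewrite indicE.
  rewrite indicE; case: (pselect (forall s, B s (Z s w))) => [H|H].
    rewrite mem_set// big1// => s _; rewrite mem_set//.
  have [s Hs] : exists s, ~ B s (Z s w).
    by apply: contrapT => /forallNP H'; apply: H => s; exact: contrapT.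
  by rewrite memNset// (bigD1 s)//= memNset// mul0r.
pose k' := Ordinal km.
pose G w := \prod_(s | s != k') F k B s w.
pose c := \prod_(s < m | s != k') (if (s < k)%N then M else q (B s)).
have sk (s : 'I_m) : s != k' -> (s < k.+1)%N = (s < k)%N.
  by move=> sk; rewrite ltnS leq_eqVlt (_ : (_ == _) = false)//; apply: negbTE.
transitivity (\int[P]_w (h (Z k' w) * G w)%:E)%E.
  apply: eq_integral => w _; congr EFin; rewrite (bigD1 k')//= /F ltnSn.
  by congr (_ * _); apply: eq_bigr => s /sk ->.
rewrite (@integral_transfer _ _ _ _ _ P Q (Z k') G c)//.
- rewrite hM -EFinM; congr EFin; rewrite mulrC (bigD1 k')//= ltnSn; congr (_ * _).
  by apply: eq_bigr => s /sk ->.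
- exact: mZ.
- rewrite (_ : G = fun w => \prod_(s <- [seq s <- index_enum 'I_m | s != k'])
      F k B s w); last by apply/funext => w; rewrite big_filter.
  by apply: measurable_prod => s _; exact: mF.
- by move=> w; apply: prodr_ge0 => s _.
- by apply: prodr_ge0 => s _; case: ifP => // _; rewrite fine_ge0.
move=> A mA.
(* The induction hypothesis with [A] in place of the [k]-th set is exactly the identity on
   indicators required by [integral_transfer]. *)
pose B' s := if s == k' then A else B s.
have mB' s : measurable (B' s) by rewrite /B'; case: ifP => _; [exact: mA|exact: mB].
have := IH (ltnW km) B' mB'.
rewrite [in RHS](bigD1 k')//= ltnn /B' eqxx EFinM muleC -qE//.
rewrite (_ : \prod_(i < m | _) _ = c).
  move=> <-; apply: eq_integral => w _; congr EFin.
  rewrite [RHS](bigD1 k')//=; congr (_ * _); first by rewrite /F /= ltnn eqxx.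
  by apply: eq_bigr => s /negPf sk'; rewrite /F sk'.
by apply: eq_bigr => s /negPf ->.
Qed.

(** Markov's inequality in exponential form: the indicator of [A] is at most [exp (f - a)]. *)
Lemma chernoff (f : T -> R) (a M : R) (A : set T) : measurable A ->
  measurable_fun [set: T] f ->
  (\int[P]_w (expR (f w))%:E <= M%:E)%E ->
  (forall w, A w -> a <= f w) -> (P A <= (M * expR (- a))%:E)%E.
Proof.
move=> mA mf fM Aa.
have -> : P A = (\int[P]_w (\1_A w)%:E)%E by rewrite integral_indic// setIT.
rewrite EFinM muleC.
apply: (@le_trans _ _ ((expR (- a))%:E * \int[P]_w (expR (f w))%:E)%E).
  rewrite -ge0_integralZl_EFin ?expR_ge0//; last first.
    by apply/measurable_EFinP; exact: measurableT_comp.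
  apply: ge0_le_integral => //.
  - by apply/measurable_EFinP; exact: measurable_indic.
  - apply/measurable_EFinP; apply: measurable_funM => //; exact: measurableT_comp.
  move=> w _; rewrite lee_fin indicE; case: (boolP (w \in A)) => [/set_mem wA|_].
    by rewrite -expRD -[leLHS]expR0 ler_expR addrC subr_ge0 Aa.
  by rewrite mulr_ge0 ?expR_ge0.
by rewrite lee_wpmul2l// lee_fin expR_ge0.
Qed.

End IndependentProducts.

(** * Tail bounds for linear forms of Gaussian columns *)

(** Links the sigma-algebra in [independent_vectors], generated by open sets of vectors, to
    measurable sets of reals. The sets [B] with the stated property form a sigma-algebra, and it
    contains the open intervals because a linear form is continuous. *)
Lemma borel_linear_form (R : realType) n (x : 'cV[R]_n) (B : set R) :
  measurable B ->
  <<s [set U : set 'cV[R]_n | open U] >> [set v | B ((x^T *m v) 0 0)].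
Proof.
pose l (v : 'cV[R]_n) := (x^T *m v) 0 0.
have lc : continuous l.
  rewrite (_ : l = fun v => \sum_k x k 0 * v k 0); last first.
    by apply/funext => u; rewrite /l mxE; apply: eq_bigr => k _; rewrite mxE.
  apply: continuous_big => [|k _ v]; first exact: add_continuous.
  exact: (continuous_comp (@coord_continuous _ _ _ k 0 v)
    (@mulrl_continuous _ (x k 0) _)).
rewrite -[measurable B]/((@ocitv R).-sigma.-measurable B) RGenOpens.measurableE.
move: B; apply: smallest_sub => /=.
  split => /=.
  - exact: sigma_algebra0.
  - move=> A /= sA.
    rewrite (_ : mkset _ = [set: 'cV_n] `\` [set v | A (l v)]).
      exact: sigma_algebraCD.
    by apply/seteqP; split => v //=.
  - move=> F /= sF.
    by rewrite (_ : mkset _ = \bigcup_i [set v | F i (l v)]) //; exact: sigma_algebra_bigcup.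
move=> _ [a [b ->]]; apply: sub_sigma_algebra => /=.
by move/continuousP: lc => /(_ `]a, b[%classic); apply; exact: interval_open.
Qed.

Section NormalColumns.
Context {d : measure_display} {T : measurableType d} {R : realType}.
Variables (P : probability T R) (n m : nat) (X : T -> 'M[R]_(n, m)).
Variables (S : 'M[R]_n) (x : 'cV[R]_n).
Hypothesis XN : iid_normal_columns P X 0 S.
Hypothesis xS : 0 < bform S x x.

Definition col_form (s : 'I_m) (w : T) : R := (x^T *m col s (X w)) 0 0.

Let sigma := Num.sqrt (bform S x x).
Let sigma_gt0 : 0 < sigma. Proof. by rewrite sqrtr_gt0. Qed.

Lemma measurable_col_form s : measurable_fun [set: T] (col_form s).
Proof.
rewrite (_ : col_form s = fun w => \sum_k x k 0 * col s (X w) k 0).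
  by apply: measurable_sum => k; apply: measurable_funM => //; exact: (XN.1 s).1.
by apply/funext => w; rewrite /col_form mxE; apply: eq_bigr => k _; rewrite mxE.
Qed.

(** Projecting on [x] leaves independent centered real normal variables with common deviation
    [sigma]; [xS] excludes the degenerate branch of [normal_vector]. *)
Lemma col_form_indep (B : 'I_m -> set R) : (forall s, measurable (B s)) ->
  P [set w | forall s, B s (col_form s w)] =
  (\prod_(s < m) normal_prob 0 sigma (B s))%E.
Proof.
move=> mB; rewrite (XN.2 (fun s => [set v | B s ((x^T *m v) 0 0)])); last first.
  by move=> s; exact: borel_linear_form.
apply: eq_bigr => s _.
have -> : P ((fun w => col s (X w)) @^-1` [set v | B s ((x^T *m v) 0 0)]) =
  if bform S x x == 0 then \d_((x^T *m (0 : 'cV_n)) 0 0) (B s)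
  else normal_prob ((x^T *m (0 : 'cV_n)) 0 0) sigma (B s).
  exact: ((XN.1 s).2 x (B s) (mB s)).
have -> : (x^T *m (0 : 'cV[R]_n)) 0 0 = 0 by rewrite mulmx0 mxE.
by rewrite (gt_eqF xS).
Qed.

Lemma measurable_sum_col_form (g : R -> R) : measurable_fun [set: R] g ->
  measurable_fun [set: T] (fun w => \sum_s g (col_form s w)).
Proof.
move=> mg; apply: measurable_sum => s; apply: measurableT_comp => //.
exact: measurable_col_form.
Qed.

(** Chernoff bound for a sum of independent terms: [b] bounds the logarithm of the exponential
    moment of one term, and the Chernoff parameter is absorbed into [g]. *)
Lemma col_form_tail (g : R -> R) (a b : R) : measurable_fun [set: R] g ->
  (\int[normal_prob 0 sigma]_y (expR (g y))%:E <= (expR b)%:E)%E ->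
  (P [set w | (a <= \sum_s g (col_form s w))%R] <= (expR (m%:R * b - a))%:E)%E.
Proof.
move=> mg gb.
have mG := measurable_sum_col_form mg.
have me : measurable_fun [set: R] (fun y => expR (g y)) by exact: measurableT_comp.
have i0 : (0 <= \int[normal_prob 0 sigma]_y (expR (g y))%:E)%E.
  by apply: integral_ge0 => y _; rewrite lee_fin expR_ge0.
have [M ME] : exists M, (\int[normal_prob 0 sigma]_y (expR (g y))%:E = M%:E)%E.
  exists (fine (\int[normal_prob 0 sigma]_y (expR (g y))%:E)); rewrite fineK//.
  by rewrite ge0_fin_numE// (le_lt_trans gb)// ltry.
rewrite ME lee_fin in gb; rewrite ME lee_fin in i0.
rewrite expRD; apply: (chernoff (f := fun w => \sum_s g (col_form s w))) => //.
  rewrite -[X in measurable X]setTI; apply: measurable_fun_le => //.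
under eq_integral do rewrite expR_sum.
rewrite (expectation_prod measurable_col_form col_form_indep me _ ME)//.
  by rewrite lee_fin expRM_natl lerXn2r// ?nnegrE ?expR_ge0.
Qed.

(** Both tails of the normalized sum of squares, and both tails of the normalized sum. The latter
    control the correction due to the sample mean. *)
Definition col_form_bad (dl : R) : set T :=
  [set w | m%:R * (1 + dl) <= \sum_s (col_form s w / sigma) ^+ 2] `|`
  [set w | \sum_s (col_form s w / sigma) ^+ 2 <= m%:R * (1 - dl)] `|`
  ([set w | m%:R * dl <= \sum_s (col_form s w / sigma)] `|`
  [set w | \sum_s (col_form s w / sigma) <= - (m%:R * dl)]).

Lemma measurable_col_form_bad dl : measurable (col_form_bad dl).
Proof.
have m1 : measurable_fun [set: T] (fun w => \sum_s (col_form s w / sigma)).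
  apply: (measurable_sum_col_form (g := fun y => y / sigma)).
  exact: measurable_funM.
have m2 : measurable_fun [set: T] (fun w => \sum_s (col_form s w / sigma) ^+ 2).
  apply: (measurable_sum_col_form (g := fun y => (y / sigma) ^+ 2)).
  by apply: measurable_funX; apply: measurable_funM.
by apply: measurableU; apply: measurableU;
  rewrite -[X in measurable X]setTI; apply: measurable_fun_le.
Qed.

(* The parameter l = dl / 8 minimizes the exponent 4 l ^ 2 - l dl. *)
Lemma col_form_bad_prob dl : 0 < dl <= 1 ->
  (P (col_form_bad dl) <= (4 * expR (- (m%:R * dl ^+ 2 / 16)))%:E)%E.
Proof.
move=> /andP[d0 d1].
have sq l : l <= 4^-1 -> (\int[normal_prob 0 sigma]_y (expR (l * (y / sigma) ^+ 2))%:E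
    <= (expR (l + 4 * l ^+ 2))%:E)%E.
  move=> l4; rewrite integral_normal_sqr_exp//; last lra.
  by rewrite lee_fin sqrt_exp_le.
have msq l : measurable_fun [set: R] (fun y => l * (y / sigma) ^+ 2).
  by apply: measurable_funM => //; apply: measurable_funX; apply: measurable_funM.
have ml l : measurable_fun [set: R] (fun y => l * (y / sigma)).
  by apply: measurable_funM => //; apply: measurable_funM.
have li l := integral_normal_exp l sigma_gt0.
have m0 : 0 <= m%:R :> R by [].
have md0 : 0 <= m%:R * dl ^+ 2 by rewrite mulr_ge0// sqr_ge0.
have b1 : (P [set w | (m%:R * (1 + dl) <= \sum_s (col_form s w / sigma) ^+ 2)%R] <=
    (expR (- (m%:R * dl ^+ 2 / 16)))%:E)%E.
  pose l := dl / 8.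
  apply: (@le_trans _ _
      (expR (m%:R * (l + 4 * l ^+ 2) - l * (m%:R * (1 + dl))))%:E).
    rewrite (_ : [set w | _] = [set w |
        l * (m%:R * (1 + dl)) <= \sum_s l * (col_form s w / sigma) ^+ 2]).
      by apply: (col_form_tail (g := fun y => l * (y / sigma) ^+ 2));
        [exact: msq|apply: sq; rewrite /l; lra].
    by apply/seteqP; split => w /=; rewrite -mulr_sumr ler_pM2l// divr_gt0.
  by rewrite lee_fin ler_expR le_eqVlt; apply/orP; left; apply/eqP; rewrite /l; field.
have b2 : (P [set w | (\sum_s (col_form s w / sigma) ^+ 2 <= m%:R * (1 - dl))%R] <=
    (expR (- (m%:R * dl ^+ 2 / 16)))%:E)%E.
  (* A negative parameter turns the lower tail into an upper one, with the same exponent. *)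
  pose l := - (dl / 8).
  apply: (@le_trans _ _
      (expR (m%:R * (l + 4 * l ^+ 2) - l * (m%:R * (1 - dl))))%:E).
    rewrite (_ : [set w | _] = [set w |
        l * (m%:R * (1 - dl)) <= \sum_s l * (col_form s w / sigma) ^+ 2]).
      by apply: (col_form_tail (g := fun y => l * (y / sigma) ^+ 2));
        [exact: msq|apply: sq; rewrite /l; lra].
    apply/seteqP; split => w /=;
      by rewrite -mulr_sumr ler_nM2l// oppr_lt0 divr_gt0.
  by rewrite lee_fin ler_expR le_eqVlt; apply/orP; left; apply/eqP; rewrite /l; field.
have b3 : (P [set w | (m%:R * dl <= \sum_s (col_form s w / sigma))%R] <=
    (expR (- (m%:R * dl ^+ 2 / 16)))%:E)%E.
  (* For the linear sum the parameter [dl] gives exponent [- m dl^2 / 2], stronger than the common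
     bound. *)
  apply: (@le_trans _ _ (expR (m%:R * (dl ^+ 2 / 2) - dl * (m%:R * dl)))%:E).
    rewrite (_ : [set w | _] = [set w |
        dl * (m%:R * dl) <= \sum_s dl * (col_form s w / sigma)]).
      by apply: (col_form_tail (g := fun y => dl * (y / sigma))); rewrite ?li.
    by apply/seteqP; split => w /=; rewrite -mulr_sumr ler_pM2l.
  by rewrite lee_fin ler_expR; lra.
have b4 : (P [set w | (\sum_s (col_form s w / sigma) <= - (m%:R * dl))%R] <=
    (expR (- (m%:R * dl ^+ 2 / 16)))%:E)%E.
  apply: (@le_trans _ _ (expR (m%:R * ((- dl) ^+ 2 / 2) - dl * (m%:R * dl)))%:E).
    rewrite (_ : [set w | _] = [set w |
        dl * (m%:R * dl) <= \sum_s - dl * (col_form s w / sigma)]).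
      by apply: (col_form_tail (g := fun y => - dl * (y / sigma))); rewrite ?li.
    apply/seteqP; split => w /=;
      by rewrite -mulr_sumr mulNr -mulrN ler_pM2l// lerNr.
  by rewrite lee_fin ler_expR sqrrN; lra.
have m1 : measurable_fun [set: T] (fun w => \sum_s (col_form s w / sigma)).
  apply: (measurable_sum_col_form (g := fun y => y / sigma)).
  exact: measurable_funM.
have m2 : measurable_fun [set: T] (fun w => \sum_s (col_form s w / sigma) ^+ 2).
  apply: (measurable_sum_col_form (g := fun y => (y / sigma) ^+ 2)).
  by apply: measurable_funX; apply: measurable_funM.
have E : 4 * expR (- (m%:R * dl ^+ 2 / 16)) = (expR (- (m%:R * dl ^+ 2 / 16)) +
   expR (- (m%:R * dl ^+ 2 / 16))) + (expR (- (m%:R * dl ^+ 2 / 16)) +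
   expR (- (m%:R * dl ^+ 2 / 16))) by ring.
rewrite E !EFinD.
have mle f g : measurable_fun [set: T] f -> measurable_fun [set: T] g ->
    measurable [set w | (f w <= g w :> R)%R].
  by move=> mf mg; rewrite -[X in measurable X]setTI; apply: measurable_fun_le.
apply: (le_trans (measureU2 _ _ _)).
- by apply: measurableU; apply: mle.
- by apply: measurableU; apply: mle.
apply: leeD; apply: (le_trans (measureU2 _ _ _)); try exact: mle; exact: leeD.
Qed.

End NormalColumns.

(** * Sample covariance and measurability *)

Section SampleCovariance.
Context {R : realType} {n m : nat}.
Variable X : 'M[R]_(n, m).

Lemma sample_cov_sym : symmx (sample_cov X).
Proof.
rewrite /symmx /sample_cov linearZ /= linear_sum /=; congr (_ *: _).
by apply: eq_bigr => s _; rewrite trmx_mul trmxK.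
Qed.

Lemma bform_outer (u x : 'cV[R]_n) :
  bform (u *m u^T) x x = (x^T *m u) 0 0 ^+ 2.
Proof.
rewrite /bform mulmxA -mulmxA [LHS]mxE big_ord1 expr2; congr (_ * _).
by rewrite -[u^T *m x]trmxK trmx_mul trmxK mxE.
Qed.

(** The usual variance identity for the projected data. It also holds at [m = 1], where the inverse
    of [m - 1] is 0 by convention. *)
Lemma bform_sample_cov (x : 'cV[R]_n) : (0 < m)%N ->
  let y s := (x^T *m col s X) 0 0 in
  bform (sample_cov X) x x =
  (m%:R - 1)^-1 * (\sum_s y s ^+ 2 - (\sum_s y s) ^+ 2 / m%:R).
Proof.
move=> m0 y; have mn0 : m%:R != 0 :> R by rewrite pnatr_eq0 -lt0n.
rewrite bform_scalemx bform_summx; congr (_ * _).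
set b := m%:R^-1 * \sum_s y s.
have yb s : (x^T *m (col s X - sample_mean X)) 0 0 = y s - b.
  rewrite mulmxBr [LHS]mxE [X in _ + X = _]mxE; congr (_ - _).
  by rewrite -scalemxAr mulmx_sumr [LHS]mxE summxE.
transitivity (\sum_s (y s - b) ^+ 2).
  by apply: eq_bigr => s _; rewrite bform_outer yb.
transitivity (\sum_s y s ^+ 2 - 2 * b * \sum_s y s + m%:R * b ^+ 2).
  rewrite mulr_sumr -sumrB.
  have -> : m%:R * b ^+ 2 = \sum_(s < m) b ^+ 2 by rewrite sumr_const card_ord mulr_natl.
  by rewrite -big_split /=; apply: eq_bigr => s _; ring.
by rewrite /b; field.
Qed.

End SampleCovariance.

(** * Positive semidefiniteness tested on integer vectors *)

Section IntegerTests.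
Variable R : realType.

Definition int_vector n (z : 'cV[int]_n) : 'cV[R]_n := map_mx intr z.

Lemma bform_bounded n (A : 'M[R]_n) (u v : 'cV[R]_n) (a b : R) :
  (forall i, `|u i 0| <= a) -> (forall i, `|v i 0| <= b) ->
  `|bform A u v| <= a * b * entry_sum A.
Proof.
move=> ua vb; rewrite bformE (le_trans (ler_norm_sum _ _ _))// mulr_sumr.
apply: ler_sum => i _; rewrite (le_trans (ler_norm_sum _ _ _))// mulr_sumr.
apply: ler_sum => j _; rewrite !normrM mulrAC ler_wpM2r//.
exact: ler_pM.
Qed.

(* Integer vectors suffice by homogeneity: the integer part of k u is at
   bounded distance from k u, so a negative value at u would persist. *)
Lemma psd_int_vector n (A : 'M[R]_n) :
  (forall z, 0 <= bform A (int_vector z) (int_vector z)) -> psdmx A.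
Proof.
move=> H u; rewrite leNgt; apply/negP => u0.
pose a := \sum_i `|u i 0|.
have ua i : `|u i 0| <= a by rewrite /a (bigD1 i)//= lerDl sumr_ge0.
have a0 : 0 <= a by apply: sumr_ge0.
pose C := entry_sum A; have C0 : 0 <= C by exact: entry_sum_ge0.
set c := - bform A u u; have c0 : 0 < c by rewrite oppr_gt0.
(* At [k u - e] the quadratic term is [- k^2 c] and the remaining terms are at most
   [(2 a k + 1) C <= k (2 a + 1) C]. *)
have key (k : nat) : (0 < k)%N -> k%:R * c <= (2 * a + 1) * C.
  move=> k0; have kr0 : 1 <= k%:R :> R by rewrite ler1n.
  pose z : 'cV[int]_n := \col_i Num.floor (k%:R * u i 0).
  pose e := k%:R *: u - int_vector z.
  have e1 i : `|e i 0| <= 1.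
    rewrite !mxE ger0_norm ?subr_ge0 ?floor_le_tmp//.
    by have := floorD1_gt (k%:R * u i 0); rewrite intrD lerBlDl => /ltW.
  have zE : int_vector z = k%:R *: u - e by rewrite subKr.
  have := H z; rewrite zE.
  have -> : bform A (k%:R *: u - e) (k%:R *: u - e) =
     k%:R ^+ 2 * bform A u u - k%:R * (bform A u e + bform A e u) + bform A e e.
    by rewrite -scaleN1r !(bformDl, bformDr, bformZl, bformZr); ring.
  have := bform_bounded A ua e1; have := bform_bounded A e1 ua; have := bform_bounded A e1 e1.
  rewrite -/C !ler_norml => /andP[_ h1] /andP[h2 _] /andP[h3 _] h4.
  rewrite -(ler_pM2l (lt_le_trans ltr01 kr0)) /c.
  nra.
have := key (Num.truncn ((2 * a + 1) * C / c)).+1 isT.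
rewrite -ler_pdivlMr// leNgt => /negP; apply.
exact: truncnS_gt.
Qed.

End IntegerTests.

(** * Measurability of matrix-valued maps *)

Section MeasurableMatrices.
Context {d : measure_display} {T : measurableType d} {R : realType}.
Variable D : set T.

(** Relative to [D], so that inverses can be restricted to a set on which the matrices are
    invertible. *)
Definition measurable_mx n m (M : T -> 'M[R]_(n, m)) : Prop :=
  forall i j, measurable_fun D (fun w => M w i j).

Lemma measurable_det n (M : T -> 'M[R]_n) : measurable_mx M ->
  measurable_fun D (fun w => \det (M w)).
Proof.
move=> mM; apply: measurable_sum => s; apply: measurable_funM => //.
by apply: measurable_prod => i _; exact: mM.
Qed.

Lemma measurable_mx_adj n (M : T -> 'M[R]_n) : measurable_mx M ->
  measurable_mx (fun w => \adj (M w)).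
Proof.
move=> mM i j; rewrite (_ : (fun _ => _) =
    fun w => (-1) ^+ (j + i) * \det (row' j (col' i (M w)))); last first.
  by apply/funext => w; rewrite mxE.
apply: measurable_funM => //; apply: measurable_det => k l.
rewrite (_ : (fun _ => _) = fun w => M w (lift j k) (lift i l)) //.
by apply/funext => w; rewrite !mxE.
Qed.

Lemma measurable_mxZ n (f : T -> R) (M : T -> 'M[R]_n) :
  measurable_fun D f -> measurable_mx M -> measurable_mx (fun w => f w *: M w).
Proof.
move=> mf mM i j; rewrite (_ : (fun _ => _) = fun w => f w * M w i j).
  by apply: measurable_funM => //; exact: mM.
by apply/funext => w; rewrite mxE.
Qed.

Lemma measurable_mxD n (M N : T -> 'M[R]_n) :
  measurable_mx M -> measurable_mx N -> measurable_mx (fun w => M w + N w).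
Proof.
move=> mM mN i j; rewrite (_ : (fun _ => _) = fun w => M w i j + N w i j).
  by apply: measurable_funD; [exact: mM|exact: mN].
by apply/funext => w; rewrite mxE.
Qed.

Lemma measurable_mx_sum n (I : finType) (M : I -> T -> 'M[R]_n) :
  (forall i, measurable_mx (M i)) -> measurable_mx (fun w => \sum_i M i w).
Proof.
move=> mM i j; rewrite (_ : (fun _ => _) = fun w => \sum_k M k w i j).
  by apply: measurable_sum => k; exact: mM.
by apply/funext => w; rewrite summxE.
Qed.

Lemma measurable_mx_tens n (M N : T -> 'M[R]_n) :
  measurable_mx M -> measurable_mx N -> measurable_mx (fun w => tensmx (M w) (N w)).
Proof.
move=> mM mN i j.
case: (mxtens_indexP i) => i1 i2; case: (mxtens_indexP j) => j1 j2.
rewrite (_ : (fun _ => _) = fun w => M w i1 j1 * N w i2 j2).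
  by apply: measurable_funM; [exact: mM|exact: mN].
by apply/funext => w; rewrite tensmxE.
Qed.

Lemma measurable_mx_cst n (A : 'M[R]_n) : measurable_mx (fun=> A).
Proof. by move=> i j. Qed.

Lemma measurable_bform n (M : T -> 'M[R]_n) u v : measurable_mx M ->
  measurable_fun D (fun w => bform (M w) u v).
Proof.
move=> mM; rewrite (_ : (fun _ => _) =
    fun w => \sum_i \sum_j u i 0 * M w i j * v j 0).
  apply: measurable_sum => i; apply: measurable_sum => j.
  by apply: measurable_funM => //; apply: measurable_funM => //; exact: mM.
by apply/funext => w; rewrite bformE.
Qed.

Hypothesis mD : measurable D.

(** By the cofactor formula, valid on [D] by invertibility, entries are polynomials divided by the
    determinant, and inversion of reals is continuous away from 0. *)
Lemma measurable_mx_inv n (M : T -> 'M[R]_n) :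
  (forall w, D w -> M w \in unitmx) -> measurable_mx M ->
  measurable_mx (fun w => invmx (M w)).
Proof.
move=> uM mM i j.
apply: (eq_measurable_fun (fun w => (\det (M w))^-1 * (\adj (M w)) i j)).
  by move=> w /set_mem Dw; rewrite /invmx uM// [RHS]mxE.
apply: measurable_funM; last exact: measurable_mx_adj.
apply: (measurable_comp (F := [set x : R | x != 0]) (f := GRing.inv)).
- by apply: open_measurable; exact: open_neq.
- by move=> _ [w Dw <-] /=; rewrite -unitfE -unitmxE uM.
- apply: open_continuous_measurable_fun; first exact: open_neq.
  by move=> x /set_mem /=; exact: inv_continuous.
- exact: measurable_det.
Qed.

Lemma measurable_psd n (M : T -> 'M[R]_n) : measurable_mx M ->
  measurable (D `&` [set w | psdmx (M w)]).
Proof.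
move=> mM; rewrite (_ : _ `&` _ = [set w | forall z : 'cV[int]_n,
   (D `&` [set w | 0 <= bform (M w) (int_vector R z) (int_vector R z)]) w]).
  apply: measurable_forall => z; apply: measurable_fun_le => //.
  exact: measurable_bform.
apply/seteqP; split => w /=; first by move=> [Dw H] z.
move=> H; split; first by have [] := H 0.
by apply: psd_int_vector => z; have [] := H z.
Qed.

(** A symmetric matrix is positive definite exactly when it is semidefinite with nonzero
    determinant, and both conditions are measurable. *)
Lemma measurable_posdef n (M : T -> 'M[R]_n) :
  (forall w, symmx (M w)) -> measurable_mx M ->
  measurable (D `&` [set w | posdefmx (M w)]).
Proof.
move=> sM mM; rewrite (_ : _ `&` _ = (D `&` [set w | psdmx (M w)]) `&`
   ~` (D `&` [set w | \det (M w) = 0])).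
  apply: measurableI; first exact: measurable_psd.
  by apply: measurableC; exact: (measurable_det mM mD (measurable_set1 0)).
apply/seteqP; split => w /=.
  move=> [Dw pM]; split; first by split => //; exact: posdef_psd.
  by move=> [_ M0]; have := posdef_unit pM; rewrite unitmxE M0 unitr0.
move=> [[Dw psdM] nM]; split => //; apply: psd_unit_posdef => //.
by rewrite unitmxE unitfE; apply/negP => /eqP M0; exact: nM.
Qed.

End MeasurableMatrices.

(** * Concentration of the sample covariances *)

Section MeasurableDampening.
Context {d : measure_display} {T : measurableType d} {R : realType}.
Variables (D : set T) (mD : measurable D) (n : nat).
Variables (S : 'I_n -> T -> 'M[R]_n) (gamma : 'I_n -> R).
Hypotheses (n_gt0 : (0 < n)%N) (gamma_gt0 : forall i, 0 < gamma i).
Hypothesis mS : forall i, measurable_mx D (S i).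
Hypothesis pS : forall i w, D w -> posdefmx (S i w).

Let Sw w i := S i w.

Lemma measurable_damp_Q i : measurable_mx D (fun w => damp_Q (Sw w) gamma i).
Proof.
have g20 : 0 < 2 * gamma i by rewrite mulr_gt0.
apply: measurable_mx_inv => //; last by apply: measurable_mxZ => //; exact: mS.
by move=> w Dw; apply/posdef_unit/posdefZ => //; exact: pS.
Qed.

Lemma measurable_damp_K : measurable_mx D (fun w => damp_K (Sw w) gamma).
Proof.
apply: measurable_mx_sum => i.
by apply: measurable_mxD; apply: measurable_mx_tens;
  (exact: measurable_damp_Q || exact: measurable_mx_cst).
Qed.

Lemma measurable_damp_L : measurable_mx D (fun w => damp_L (Sw w) gamma).
Proof.
move=> i j; rewrite /damp_L; have [->|ij] := eqVneq i j.
  under eq_fun do rewrite !mxE eqxx mulr1n.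
  by apply: measurable_funD; exact: measurable_damp_Q.
under eq_fun do rewrite mxE (negbTE ij) mulr0n.
exact: measurable_cst.
Qed.

(** On [D] the largest eigenvalue is positive, so the condition reads [lambda_max <= 2 / c], that
    is, [(2 / c) L - K] is semidefinite. Measurability of [lambda_max] itself is thus bypassed. *)
Lemma measurable_max_dampening_ge (c : R) : 0 < c ->
  measurable (D `&` [set w | c <= max_dampening (Sw w) gamma]).
Proof.
move=> c0; have nn0 : (0 < n * n)%N by rewrite muln_gt0 n_gt0.
have key w : D w -> (c <= max_dampening (Sw w) gamma) <->
    psdmx ((2 / c) *: damp_L (Sw w) gamma + (-1) *: damp_K (Sw w) gamma).
  move=> Dw; have pSw i : posdefmx (Sw w i) by exact: pS.
  have l0 := lt_le_trans ltr01 (lambda_max_damp_ge1 gamma_gt0 pSw n_gt0).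
  have H := lambda_max_leP (2 / c) nn0 (damp_K_sym gamma_gt0 pSw)
    (damp_L_posdef gamma_gt0 pSw).
  rewrite /max_dampening ler_pdivlMr// mulrC -ler_pdivlMr//.
  split=> [/H KL v|psd].
    by rewrite bform_addmx !bform_scalemx mulN1r subr_ge0.
  apply/H => v; have := psd v.
  by rewrite bform_addmx !bform_scalemx mulN1r subr_ge0.
rewrite (_ : _ `&` _ = D `&` [set w | psdmx
    ((2 / c) *: damp_L (Sw w) gamma + (-1) *: damp_K (Sw w) gamma)]).
  apply: measurable_psd => //; apply: measurable_mxD; apply: measurable_mxZ => //.
    exact: measurable_damp_L.
  exact: measurable_damp_K.
by apply/seteqP; split => w /= [Dw /(key w Dw)].
Qed.

End MeasurableDampening.

(** * Deviation of the quadratic forms and union bound *)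

Section Concentration.
Context {d : measure_display} {T : measurableType d} {R : realType}.
Variable P : probability T R.

Lemma union_bound (I : finType) (A : I -> set T) :
  (forall i, measurable (A i)) ->
  measurable [set w | exists i, A i w] /\
  (P [set w | exists i, A i w] <= \sum_i P (A i))%E.
Proof.
move=> mA.
suff H (s : seq I) : measurable [set w | exists2 i, i \in s & A i w] /\
    (P [set w | exists2 i, i \in s & A i w] <= \sum_(i <- s) P (A i))%E.
  have -> : [set w | exists i, A i w] = [set w | exists2 i, i \in index_enum I & A i w].
    by apply/seteqP; split => w /= [i]; [exists i; rewrite ?mem_index_enum|exists i].
  exact: H.
elim: s => [|i s [mE PE]].
  rewrite (_ : [set _ | _] = set0); first by rewrite big_nil measure0.
  by apply/seteqP; split => w //= -[].
rewrite (_ : [set _ | _] = A i `|` [set w | exists2 i, i \in s & A i w]).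
  split; first exact: measurableU.
  by rewrite big_cons (le_trans (measureU2 _ _ _))// leeD.
apply/seteqP; split => w /=.
  by move=> [j]; rewrite inE => /predU1P[->|js] Aj; [left|right; exists j].
by move=> [Ai|[j js Aj]]; [exists i; rewrite ?mem_head|exists j; rewrite ?inE ?js ?orbT].
Qed.

(** Off the bad event the normalized sum of squares is within [m dl] of [m], and the mean correction
    is at most [m dl^2]. Dividing by [m - 1] instead of [m] costs a further 1, absorbed by
    [1 <= (m - 1) dl]; altogether the factor 3 suffices. *)
Lemma sample_cov_form_dev n m (X : T -> 'M[R]_(n, m)) (S : 'M[R]_n)
    (x : 'cV[R]_n) (dl : R) w :
  0 < bform S x x -> 0 < dl <= 2^-1 -> 1 <= (m%:R - 1) * dl ->
  ~ col_form_bad X S x dl w ->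
  `|bform (sample_cov (X w) - S) x x| <= 3 * dl * bform S x x.
Proof.
move=> S0 /andP[d0 d2] md /not_orP[/not_orP[/negP b1 /negP b2] /not_orP[/negP b3 /negP b4]].
move: b1 b2 b3 b4; rewrite -!ltNge.
set s := Num.sqrt _; set U := \sum_s _ => h1 h2; set V := \sum_s _ => h3 h4.
have s0 : 0 < s by rewrite sqrtr_gt0.
have s2 : s ^+ 2 = bform S x x by rewrite sqr_sqrtr// ltW.
have m1 : 0 < m%:R - 1 :> R by rewrite -(pmulr_lgt0 _ d0) (lt_le_trans ltr01).
have mR : 0 < m%:R :> R by lra.
have m0 : (0 < m)%N by rewrite -(ltr0n R).
rewrite bform_addmx bform_oppmx bform_sample_cov// -s2.
have -> : \sum_s0 (x^T *m col s0 (X w)) 0 0 ^+ 2 = s ^+ 2 * U.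
  rewrite mulr_sumr; apply: eq_bigr => k _.
  by rewrite exprMn mulrCA -exprMn mulfV ?gt_eqF// expr1n mulr1.
have -> : \sum_s0 (x^T *m col s0 (X w)) 0 0 = s * V.
  rewrite mulr_sumr; apply: eq_bigr => k _.
  by rewrite mulrCA mulfV ?gt_eqF// mulr1.
set W := V ^+ 2 / m%:R.
have W0 : 0 <= W by rewrite divr_ge0 ?sqr_ge0// ltW.
have W1 : W <= m%:R * dl ^+ 2.
  rewrite ler_pdivrMr// (_ : _ * _ * _ = (m%:R * dl) ^+ 2); last by ring.
  by rewrite -[leLHS]real_normK ?num_real// ler_sqr ?nnegrE ?mulr_ge0 ?(ltW d0)// ler_norml !ltW.
have -> : (m%:R - 1)^-1 * (s ^+ 2 * U - (s * V) ^+ 2 / m%:R) - s ^+ 2 =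
   s ^+ 2 * ((U - W - (m%:R - 1)) / (m%:R - 1)).
  by rewrite /W; field; rewrite !gt_eqF.
rewrite normrM gtr0_norm ?exprn_gt0// mulrC ler_pM2r ?exprn_gt0//.
rewrite normrM [X in _ * X]gtr0_norm ?invr_gt0// ler_pdivrMr// ler_norml.
apply/andP; split.
  nra.
nra.
Qed.

Lemma sample_cov_concentration n m (X : 'I_n -> T -> 'M[R]_(n, m)) (S : 'M[R]_n)
    (C dl : R) :
  posdefmx S -> (forall v, bform S v v <= C * sqnorm v) -> 0 <= C ->
  0 < dl <= 2^-1 -> 1 <= (m%:R - 1) * dl ->
  (forall i, iid_normal_columns P (X i) 0 S) ->
  exists2 B, measurable B &
    (P B <= (n%:R * (2 ^+ (16 * n) * 4 ^+ n) * (4 * expR (- (m%:R * dl ^+ 2 / 16))))%:E)%E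
    /\ forall w, ~ B w -> forall i v,
      `|bform (sample_cov (X i w) - S) v v| <= 6 * C * dl * sqnorm v.
Proof.
move=> pS SC C0 dl01 md XN; have [d0 d2] := andP dl01.
pose I : finType := ('I_n * {ffun 'I_n -> bool * 'I_(16 * n).+1})%type.
(* The zero vector is left out: its projection is degenerate, and the desired bound is trivial
   there. *)
pose ok (p : I) := (p.2 \in net n (16 * n)) && (net_vector R p.2 != 0).
pose A (p : I) := if ok p then col_form_bad (X p.1) S (net_vector R p.2) dl else set0.
have S0 p : ok p -> 0 < bform S (net_vector R p.2) (net_vector R p.2).
  by move=> /andP[_ ?]; exact: pS.2.
have mA p : measurable (A p).
  rewrite /A; case: ifPn => // /S0 ?; exact: measurable_col_form_bad (XN p.1) _.
have [mB PB] := union_bound mA.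
exists [set w | exists p, A p w] => //; split.
  apply: (le_trans PB).
  pose e := 4 * expR (- (m%:R * dl ^+ 2 / 16)).
  have e0 : 0 <= e by rewrite mulr_ge0// expR_ge0.
  apply: (@le_trans _ _ (\sum_(p : I) (if p.2 \in net n (16 * n) then e else 0)%:E)%E).
    apply: lee_sum => p _; rewrite /A; case: ifPn => [okp|_].
      have /andP[-> _] := okp; apply: (col_form_bad_prob (XN p.1)); first exact: S0.
      by rewrite d0 /=; lra.
    by rewrite measure0 lee_fin; case: ifP.
  rewrite sumEFin lee_fin.
  rewrite -(pair_bigA _ (fun (i : 'I_n) f => if f \in net n (16 * n) then e else 0))/=.
  rewrite sumr_const card_ord -[leLHS]mulr_natl -mulrA ler_wpM2l//.
  by rewrite -big_mkcond /= sumr_const -[leLHS]mulr_natl ler_wpM2r// card_net.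
move=> w nB i v.
(* The 2 is lost in passing from the net to all vectors, the 3 is that of [sample_cov_form_dev], and
   [C] compares [S] with the identity. *)
have -> : 6 * C * dl = 2 * (3 * dl * C) by ring.
apply: net_bform.
- by rewrite /symmx linearB /= sample_cov_sym pS.1.
- by rewrite mulr_ge0// mulr_ge0// ltW.
move=> f fN; have [->|f0] := eqVneq (net_vector R f) 0.
  by rewrite -bform1 /bform !mulmx0 mxE normr0 mulr0.
have okf : ok (i, f) by apply/andP.
apply: (@le_trans _ _ (3 * dl * bform S (net_vector R f) (net_vector R f))).
  apply: sample_cov_form_dev => //; first exact: (S0 (i, f)).
  by move=> bad; apply: nB; exists (i, f); rewrite /A okf.
by rewrite -[leRHS]mulrA ler_wpM2l// mulr_ge0// ltW.
Qed.

End Concentration.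

(** * Choice of the parameters and asymptotics *)

Lemma sample_size_ge (R : realType) n : (0 < n)%N ->
  n%:R * ln n%:R <= (sample_size R n)%:R :> R.
Proof.
move=> n0; apply: (le_trans (ceil_ge _)).
have h0 : 0 <= n%:R * ln n%:R :> R by rewrite mulr_ge0// ln_ge0// ler1n.
rewrite /sample_size natr_absz ger0_norm// ceil_ge0.
by rewrite (lt_le_trans _ h0)// ltrN10.
Qed.

(* Number of samples, times size of the net, times constant of the tail bound. *)
Lemma union_bound_size (R : realType) n : (0 < n)%N ->
  n%:R * (2 ^+ (16 * n) * 4 ^+ n) * 4 <= expR (21 * n%:R) :> R.
Proof.
(* [n <= 2^n], [4 <= 2^(2 n)] and [2^(16 n) 4^n = 2^(18 n)] give 21 = 1 + 2 + 18; then
   [2 <= exp 1]. *)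
move=> n0; apply: (@le_trans _ _ (2 ^+ (21 * n))).
  have -> : n%:R * (2 ^+ (16 * n) * 4 ^+ n) * 4 = n%:R * 4 * 2 ^+ (18 * n) :> R.
    rewrite (_ : 4 = 2 ^+ 2 :> R); last by ring.
    by rewrite -exprM -exprD -mulnDl mulrAC.
  rewrite (_ : 21 = 3 + 18)%N// mulnDl exprD ler_pM2r ?exprn_gt0//.
  rewrite -natrX -natrM ler_nat (_ : 3 = 1 + 2)%N// mulnDl mul1n expnD leq_mul//.
    exact/ltnW/ltn_expl.
  by rewrite (_ : 4 = 2 ^ 2)%N// leq_exp2l// leq_pmulr.
rewrite (_ : 21 * n%:R = (21 * n)%:R * 1); last by rewrite natrM mulr1.
rewrite expRM_natl lerXn2r ?nnegrE ?expR_ge0//.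
by rewrite (le_trans _ (expR_ge1Dx 1)).
Qed.

Lemma near_ln_ge (R : realType) (a : R) : \forall n \near \oo, a <= ln n%:R.
Proof.
near=> n; have en : expR a <= n%:R by near: n; exact: nbhs_infty_ger.
by rewrite -[a]expRK ler_ln ?posrE ?expR_gt0// (lt_le_trans (expR_gt0 a)).
Unshelve. all: by end_near. Qed.

Lemma cvg_invsqrt_ln (R : realType) :
  (Num.sqrt (ln n%:R))^-1 @[n --> \oo] --> (0 : R).
Proof.
apply/gtr0_cvgV0; last first.
  apply/cvgryPge => a; near=> n.
  apply: (le_trans (ler_norm a)); rewrite -sqrtr_sqr ler_wsqrtr//.
  by near: n; exact: near_ln_ge.
near=> n; rewrite sqrtr_gt0; apply: (@lt_le_trans _ _ 1) => //.
by near: n; exact: near_ln_ge.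
Unshelve. all: by end_near. Qed.

Section Finite.
Context {d : measure_display} {T : measurableType d} {R : realType}.
Variable P : probability T R.

(** The statement for a single [n], with explicit constants: [C] and [C'] compare [S] with the
    identity from both sides, and [p] bounds the failure probability. *)
Lemma max_dampening_concentration n m (X : 'I_n -> T -> 'M[R]_(n, m))
    (S : 'M[R]_n) (gamma : 'I_n -> R) (C C' dl p : R) :
  (0 < n)%N -> posdefmx S -> (forall i, 0 < gamma i) ->
  (forall v, bform S v v <= C * sqnorm v) -> 0 < C ->
  (forall v, sqnorm v <= C' * bform S v v) -> 0 < C' ->
  0 < dl <= 2^-1 -> 12 * C * C' * dl < 1 -> 1 <= (m%:R - 1) * dl ->
  n%:R * (2 ^+ (16 * n) * 4 ^+ n) * (4 * expR (- (m%:R * dl ^+ 2 / 16))) <= p ->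
  (forall i, iid_normal_columns P (X i) 0 S) ->
  ((1 - p)%:E <=
   P [set w | ((forall i, posdefmx (sample_cov (X i w))) /\
      (1 - 12 * C * C' * dl) * max_dampening (fun=> S) gamma
        <= max_dampening (fun i => sample_cov (X i w)) gamma)%R])%E.
Proof.
move=> n0 pS g0 SC C0 SC' C'0 dl01 CCd md np XN; have [d0 d2] := andP dl01.
have [B mB [PB HB]] := sample_cov_concentration pS SC (ltW C0) dl01 md XN.
set E := [set w | _].
(* [C'] makes the deviation relative to [S], with size [e]; [max_dampening_perturb] then loses
   [2 e], hence the 12. *)
pose e := 6 * C * C' * dl.
have e0 : 0 < e by rewrite !mulr_gt0.
have e1 : e < 1 / 2 by rewrite /e; lra.
have eE : 1 - 12 * C * C' * dl = 1 - 2 * e by rewrite /e; ring.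
have mX i : measurable_mx [set: T] (fun w => sample_cov (X i w)).
  have mXe : forall k s, measurable_fun [set: T] (fun w => X i w k s).
    move=> k s; rewrite (_ : (fun _ => _) = fun w => col s (X i w) k 0).
      exact: ((XN i).1 s).1.
    by apply/funext => w; rewrite mxE.
  have mmean : forall k, measurable_fun [set: T] (fun w => sample_mean (X i w) k 0).
    move=> k; rewrite (_ : (fun _ => _) = fun w => m%:R^-1 * \sum_s X i w k s).
      by apply: measurable_funM => //; apply: measurable_sum => s.
    by apply/funext => w; rewrite mxE summxE; under eq_bigr do rewrite mxE.
  move=> k l; rewrite (_ : (fun _ => _) = fun w => (m%:R - 1)^-1 *
    \sum_s (X i w k s - sample_mean (X i w) k 0) * (X i w l s - sample_mean (X i w) l 0)).
    apply: measurable_funM => //; apply: measurable_sum => s.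
    by apply: measurable_funM; apply: measurable_funB.
  apply/funext => w; rewrite mxE summxE; congr (_ * _); apply: eq_bigr => s _.
  rewrite mxE big_ord1; congr (_ * _); first by rewrite [LHS]mxE mxE [X in _ + X]mxE.
  by rewrite mxE [LHS]mxE mxE [X in _ + X]mxE.
have sX i w : symmx (sample_cov (X i w)) by exact: sample_cov_sym.
pose D := [set w | forall i, posdefmx (sample_cov (X i w))].
have mD : measurable D.
  apply: measurable_forall => i.
  have := measurable_posdef measurableT (sX i) (mX i).
  by rewrite setTI.
have pSS (i : 'I_n) : posdefmx S by [].
have eta0 : 0 < max_dampening (fun=> S) gamma.
  by rewrite divr_gt0// (lt_le_trans ltr01)// lambda_max_damp_ge1.
have mE : measurable E.
  (* The sample covariances are invertible only on [D], so measurability is argued relative to it;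
     the threshold is positive as [12 C C' dl < 1]. *)
  rewrite (_ : E = D `&` [set w | (1 - 12 * C * C' * dl) * max_dampening (fun=> S) gamma
        <= max_dampening (fun i => sample_cov (X i w)) gamma]) //.
  apply: (measurable_max_dampening_ge mD (S := fun i w => sample_cov (X i w))) => //.
  - by move=> i k l; apply: measurable_funS (mX i k l).
  - by rewrite mulr_gt0// subr_gt0.
have BE : ~` B `<=` E.
  move=> w /HB H.
  have dev i v : `|bform (sample_cov (X i w) - S) v v| <= e * bform S v v.
    apply: (le_trans (H i v)).
    have := SC' v; have : 0 < 6 * C * dl by rewrite !mulr_gt0.
    move=> h1 h2; rewrite /e.
    have -> : 6 * C * C' * dl * bform S v v = 6 * C * dl * (C' * bform S v v) by ring.
    by rewrite ler_pM2l.
  have lo i v : (1 - e) * bform S v v <= bform (sample_cov (X i w)) v v.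
    have := dev i v; rewrite bform_addmx bform_oppmx ler_norml => /andP[h _].
    by lra.
  have hi i v : bform (sample_cov (X i w)) v v <= (1 + e) * bform S v v.
    have := dev i v; rewrite bform_addmx bform_oppmx ler_norml => /andP[_ h].
    by lra.
  have pX i : posdefmx (sample_cov (X i w)).
    split=> [|v v0]; first exact: sX.
    apply: lt_le_trans (lo i v).
    by rewrite mulr_gt0//; [lra|exact: pS.2].
  split; first exact: pX.
  rewrite eE; apply: (max_dampening_perturb n0 g0 _ pSS pX lo hi).
  by rewrite e0 /=; lra.
apply: (@le_trans _ _ (P (~` B))); last first.
  by apply: le_measure => //; rewrite inE//; exact: measurableC.
rewrite probability_setC// EFinB leeB// (le_trans PB)// lee_fin.
Qed.

End Finite.

(** [eps] and [c] are fixed before the probability space. The event includes positive definiteness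
    of the sample covariances, which makes the inverses and the largest eigenvalue in
    [max_dampening] genuine rather than default values. *)
Theorem theorem5 (R : realType) (Sigma Gamma : forall n : nat, 'M[R]_n)
    (Sigma_pos : forall n, posdefmx (Sigma n))
    (Gamma_diag : forall n, is_diag_mx (Gamma n))
    (Gamma_pos : forall n (i : 'I_n), 0 < Gamma n i i)
    (Sigma_bnd : (fun n => opnorm (Sigma n)) =O_\oo (fun=> (1 : R)))
    (SigmaV_bnd : (fun n => opnorm (invmx (Sigma n))) =O_\oo (fun=> (1 : R)))
    (Gamma_bnd : (fun n => opnorm (Gamma n)) =O_\oo (fun=> (1 : R)))
    (GammaV_bnd : (fun n => opnorm (invmx (Gamma n))) =O_\oo (fun=> (1 : R))) :
  exists (eps : nat -> R) (c : R),
    [/\ eps n @[n --> \oo] --> (0 : R), 0 < c &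
    \forall n \near \oo,
      forall (d : measure_display) (T : measurableType d) (P : probability T R)
        (X : 'I_n -> T -> 'M[R]_(n, sample_size R n)),
      (forall i, iid_normal_columns P (X i) 0 (Sigma n)) ->
      ((1 - expR (- (c * n%:R)))%:E <=
         P [set w |
             ((forall i, posdefmx (sample_cov (X i w))) /\
             (1 - eps n) * max_dampening (fun=> Sigma n) (fun i => Gamma n i i)
             <= max_dampening (fun i => sample_cov (X i w))
                              (fun i => Gamma n i i))%R])%E].
Proof.
move/eqO_exP: Sigma_bnd => [C C0 SC].
move/eqO_exP: SigmaV_bnd => [C' C'0 SC'].
(* With 20, [m dl^2 / 16 >= 25 n], which exceeds the [21 n] of [union_bound_size] by enough for the
   rate [c = 1]. *)
pose dl n : R := 20 * (Num.sqrt (ln n%:R))^-1.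
have dl_cvg : dl n @[n --> \oo] --> (0 : R).
  rewrite -(mulr0 20); apply: cvgMl_tmp; exact: cvg_invsqrt_ln.
pose eps n := 12 * C * C' * dl n.
have eps_cvg : eps n @[n --> \oo] --> (0 : R).
  by rewrite -(mulr0 (12 * C * C')); apply: cvgMl_tmp.
exists eps, 1; split => //.
near=> n.
move=> d T P X XN.
have SCn : `|opnorm (Sigma n)| <= C * `|1 : R| by near: n.
have SCn' : `|opnorm (invmx (Sigma n))| <= C' * `|1 : R| by near: n.
have epsn : eps n < 1 by near: n; exact: (cvgr_lt _ eps_cvg).
(* This makes [dl = 20 / r] at most 1/2, and it also excludes [n = 0], where [ln] is 0 by
   convention. *)
have L0 : 40 ^+ 2 <= ln n%:R :> R by near: n; exact: near_ln_ge.
rewrite normr1 mulr1 in SCn; rewrite normr1 mulr1 in SCn'.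
have n0 : (0 < n)%N.
  by rewrite lt0n; apply/eqP => n0; move: L0; rewrite n0 ln0//; lra.
have nR : 1 <= n%:R :> R by rewrite ler1n.
pose r : R := Num.sqrt (ln n%:R).
have r40 : 40 <= r by rewrite -[40]ger0_norm// -sqrtr_sqr ler_wsqrtr.
have r0 : 0 < r by rewrite (lt_le_trans _ r40).
have r2 : ln n%:R = r ^+ 2 by rewrite sqr_sqrtr// (le_trans _ L0)// exprn_ge0.
have np := @sample_size_ge R n n0.
rewrite r2 in np; set m := sample_size R n in X XN np *.
(* Gives [(m - 1) dl >= 1], since [20 (r^2 - 1) >= r] for [r >= 40]. *)
have mr : r ^+ 2 <= m%:R :> R by rewrite (le_trans _ np)// ler_peMl// sqr_ge0.
apply: (max_dampening_concentration (C := C) (C' := C')) => //.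
- move=> v; apply: (le_trans (ler_norm _)); apply: (le_trans (bform_opnorm _ _)).
  by rewrite ler_wpM2r ?sqnorm_ge0// (le_trans (ler_norm _)).
- move=> v; apply: (le_trans (bform_opnorm_inv _ (Sigma_pos n))).
  by rewrite ler_wpM2r ?posdef_psd// (le_trans (ler_norm _)).
- by rewrite /dl -/r mulr_gt0 ?invr_gt0//= ler_pdivrMr//; lra.
- by rewrite /dl -/r mulrA ler_pdivlMr//; nra.
rewrite mulrA (le_trans (ler_wpM2r (expR_ge0 _) (union_bound_size _ n0)))//.
rewrite -expRD ler_expR /dl -/r exprMn exprVn.
have : n%:R * 25 <= m%:R * (20 ^+ 2 * (r ^+ 2)^-1) / 16.
  have -> : n%:R * 25 = n%:R * r ^+ 2 * (20 ^+ 2 * (r ^+ 2)^-1) / 16.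
    by field; rewrite gt_eqF.
  by rewrite ler_pM2r// ler_pM2r// mulr_gt0 ?invr_gt0 ?exprn_gt0.
lra.
Unshelve. all: by end_near. Qed.
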